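(* There is a deterministic algorithm which, given a positive integer $n$, computes $S(n)$, the number of square-free positive integers less than or equal to $n$, in time $\tilde O(n^{2/5})$ and using memory $\tilde O(n^{1/5})$.
   Context: A positive integer is square-free if it is not divisible by the square of any integer greater than one. The notation $\tilde O$ is like $O$ but ignores logarithmic factors. Time is the number of elementary operations (arithmetic operations on integers of size polynomial in $n$ and memory accesses), and memory is the number of stored integers of size polynomial in $n$; both are considered as $n\to\infty$. *)

(* Defs.v *)
From mathcomp Require Import all_boot all_order all_algebra.
From mathcomp Require Import boolp classical_sets filter reals topology.
From mathcomp Require Import normedtype landau exp.

Set Implicit Arguments.
Unset Strict Implicit.
Unset Printing Implicit Defensive.

Import Order.TTheory GRing.Theory Num.Theory.
Import numFieldNormedType.Exports.

Local Open Scope classical_set_scope.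
Local Open Scope ring_scope.

Definition square_free (m : nat) : Prop :=
  (0 < m)%N /\ forall d : nat, (1 < d)%N -> ~~ (d ^ 2 %| m)%N.

Definition square_free_count (n : nat) : nat :=
  count (fun m => `[< square_free m >]) (iota 1 n).

(* The model of computation is a random access machine on integers, programmed
   in a structured imperative language.  A program uses the finitely many
   registers that it names, and an array of cells addressed by integers, whose
   addresses may be computed.  Memory is measured by the number of cells: the
   registers only add a constant that depends on the program alone. *)
Inductive binop := Add | Sub | Mul | Div | Mod | Eq | Le.

Inductive expr :=
| Const of int
| Reg of nat
| Read of expr
| Bin of binop & expr & expr.

Inductive cmd :=
| Skip
| Assign of nat & expr
| Write of expr & expr
| Seq of cmd & cmd
| If of expr & cmd & cmd
| While of expr & cmd.

Record state := State { regs : nat -> int; cells : int -> int }.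

(* Div and Mod are Euclidean division, so that Div is the floor when the
   divisor is positive; a quotient by 0 is 0.  Comparisons return 0 or 1. *)
Definition apply (o : binop) (x y : int) : int :=
  match o with
  | Add => x + y
  | Sub => x - y
  | Mul => x * y
  | Div => (x %/ y)%Z
  | Mod => (x %% y)%Z
  | Eq => if x == y then 1 else 0
  | Le => if x <= y then 1 else 0
  end.

Fixpoint eval_expr (s : state) (e : expr) : int :=
  match e with
  | Const z => z
  | Reg r => regs s r
  | Read a => cells s (eval_expr s a)
  | Bin o e1 e2 => apply o (eval_expr s e1) (eval_expr s e2)
  end.

(* Every constant, register access, memory access and arithmetic operation
   takes one unit of time. *)
Fixpoint cost (e : expr) : nat :=
  match e with
  | Const _ | Reg _ => 1
  | Read a => (cost a).+1
  | Bin _ e1 e2 => (cost e1 + cost e2).+1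
  end.

(* Only the addresses 0, ..., mem - 1 exist. *)
Definition address (mem : nat) (a : int) : bool := (0 <= a) && (a < mem%:Z).

(* All the values met when e is evaluated, intermediate ones included, have
   absolute value at most word, and only existing cells are read. *)
Fixpoint safe (word mem : nat) (s : state) (e : expr) : bool :=
  (`|eval_expr s e| <= word)%N &&
  match e with
  | Const _ | Reg _ => true
  | Read a => safe word mem s a && address mem (eval_expr s a)
  | Bin _ e1 e2 => safe word mem s e1 && safe word mem s e2
  end.

Definition set_reg (s : state) (r : nat) (v : int) : state :=
  State [eta regs s with r |-> v] (cells s).

Definition set_cell (s : state) (a v : int) : state :=
  State (regs s) [eta cells s with a |-> v].

(* exec word mem c s t s' : on a machine with mem cells and integers of absolute
   value at most word, c started in s stops in s' after exactly t units of time.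
   There is no rule for an unsafe evaluation: a computation that exceeds one of
   the two bounds has no result. *)
Inductive exec (word mem : nat) : cmd -> state -> nat -> state -> Prop :=
| exec_Skip s :
    exec word mem Skip s 0 s
| exec_Assign s r e :
    safe word mem s e ->
    exec word mem (Assign r e) s (cost e).+1 (set_reg s r (eval_expr s e))
| exec_Write s a e :
    safe word mem s a -> safe word mem s e -> address mem (eval_expr s a) ->
    exec word mem (Write a e) s (cost a + cost e).+1
      (set_cell s (eval_expr s a) (eval_expr s e))
| exec_Seq c1 c2 s1 s2 s3 t1 t2 :
    exec word mem c1 s1 t1 s2 -> exec word mem c2 s2 t2 s3 ->
    exec word mem (Seq c1 c2) s1 (t1 + t2) s3
| exec_IfTrue e c1 c2 s s' t :
    safe word mem s e -> eval_expr s e != 0 -> exec word mem c1 s t s' ->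
    exec word mem (If e c1 c2) s (cost e + t).+1 s'
| exec_IfFalse e c1 c2 s s' t :
    safe word mem s e -> eval_expr s e = 0 -> exec word mem c2 s t s' ->
    exec word mem (If e c1 c2) s (cost e + t).+1 s'
| exec_WhileTrue e c s1 s2 s3 t1 t2 :
    safe word mem s1 e -> eval_expr s1 e != 0 ->
    exec word mem c s1 t1 s2 -> exec word mem (While e c) s2 t2 s3 ->
    exec word mem (While e c) s1 (cost e + t1 + t2).+1 s3
| exec_WhileFalse e c s :
    safe word mem s e -> eval_expr s e = 0 ->
    exec word mem (While e c) s (cost e).+1 s.

Lemma exec_deterministic word mem c s t1 s1 t2 s2 :
  exec word mem c s t1 s1 -> exec word mem c s t2 s2 -> t1 = t2 /\ s1 = s2.
Proof.
move=> H; elim: H t2 s2 => {c s t1 s1}.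
- by move=> s t2 s2 H; inversion H.
- by move=> s r e _ t2 s2 H; inversion H.
- by move=> s a e _ _ _ t2 s2 H; inversion H.
- move=> c1 c2 s1 s2 s3 t1 t2 _ IH1 _ IH2 t s H.
  inversion H as [| | |? ? ? ? ? ? ? E1 E2| | | |]; subst.
  by have [-> eq_s] := IH1 _ _ E1; subst; have [-> ->] := IH2 _ _ E2.
- move=> e c1 c2 s s' t _ nz _ IH t2 s2 H.
  inversion H as [| | | |? ? ? ? ? ? _ _ E|? ? ? ? ? ? _ z _| |]; subst.
    by have [-> ->] := IH _ _ E.
  by rewrite z in nz.
- move=> e c1 c2 s s' t _ z _ IH t2 s2 H.
  inversion H as [| | | |? ? ? ? ? ? _ nz _|? ? ? ? ? ? _ _ E| |]; subst.
    by rewrite z in nz.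
  by have [-> ->] := IH _ _ E.
- move=> e c s1 s2 s3 t1 t2 _ nz _ IH1 _ IH2 t s H.
  inversion H as [| | | | | |? ? ? ? ? ? ? _ _ E1 E2|? ? ? _ z]; subst.
    by have [-> eq_s] := IH1 _ _ E1; subst; have [-> ->] := IH2 _ _ E2.
  by rewrite z in nz.
- move=> e c s _ z t2 s2 H.
  inversion H as [| | | | | |? ? ? ? ? ? ? _ nz _ _|]; subst => //.
  by rewrite z in nz.
Qed.

(* The input is in register 0; everything else is 0. *)
Definition init_state (n : nat) : state :=
  State [eta (fun=> 0) with 0%N |-> n%:Z] (fun=> 0).

(* The output is read in register 0. *)
Definition computes_within (c : cmd) (f : nat -> nat)
    (time memory word : nat -> nat) : Prop :=
  forall n : nat, (0 < n)%N ->
    exists2 s : state, exec (word n) (memory n) c (init_state n) (time n) s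
                     & regs s 0%N = (f n)%:Z.

Definition polynomially_bounded (f : nat -> nat) : Prop :=
  exists k : nat, \forall n \near \oo, (f n <= n ^ k)%N.

(* f(n) = O(g(n) (log n)^k) for some k. *)
Definition soft_bigO (R : realType) (f : nat -> nat) (g : nat -> R) : Prop :=
  exists k : nat,
    ((fun n => (f n)%:R) : nat -> R^o)
      =O_\oo ((fun n => g n * ln n%:R ^+ k) : nat -> R^o).

(* Main.v *)
Require Import Defs.
From mathcomp Require Import all_boot all_order all_algebra.
From mathcomp Require Import boolp classical_sets filter reals topology.
From mathcomp Require Import normedtype landau exp.
From mathcomp Require Import zify ring lra.

Set Implicit Arguments.
Unset Strict Implicit.
Unset Printing Implicit Defensive.

Import Order.TTheory GRing.Theory Num.Theory.
Import numFieldNormedType.Exports.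
Local Open Scope ring_scope.

(** Write mu for the Moebius function and M(x) for the sum of mu(d) over
    d <= x.  Every m is uniquely a square-free number times a square, so
    [m square-free] is the sum of mu(d) over d^2 | m, and summing over m <= n

      S(n) = sum_d mu(d) floor(n / d^2).

    Choose B near n^(1/5) and cut the sum at D = B^2.  For d > D the quotient
    floor(n / d^2) counts the i with d <= x_i, where x_i = floor(sqrt(n / i));
    only the i <= I = floor(n / (D+1)^2) < B occur, and therefore
    (square_free_count_split)

      S(n) = sum_(d <= D) mu(d) floor(n / d^2) + sum_(i <= I) (M(x_i) - M(D)).

    The values M(x_i) come from sum_(d <= x) M(floor(x / d)) = 1 (sum_mertens).
    For x = x_i the terms with d <= x / (D+1) are M(x_j) with j = i d^2 <= I
    because floor(x_i / d) = x_(i d^2) (qroot_div, leq_index); they are known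
    when i is treated in decreasing order.  All the other terms are values
    M(v) with v <= D.

    The program therefore sieves [1, D] in B segments of length B, keeping one
    segment and two tables indexed by i <= I in memory: O(n^(1/5)) cells.
    Within a segment mu is computed by dividing every m by d = 2, ..., B in
    turn (sieve_valueP, sieve_value_mu), in time O(B log B); as soon as
    M is known on the segment, each i subtracts from its running value the
    terms M(floor(x_i / d)) whose argument lies in the segment, one block of
    equal quotients at a time (triple_group).

    For one i, a segment costs at most min(B, number of d landing in it).
    With J = floor(B / i) + 1, the first J segments cost at most B each, and
    the later ones involve at most x_i / (J B) <= J B values of d altogether,
    since x_i^2 i <= n < B^5 <= (J B)^4 i (sum_hits_leq).  Summing 2 J B
    over i gives a harmonic sum, hence O(B^2 log B) = O(n^(2/5) log n)
    (harmonic_sum_leq, total_time_leq).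

    The program is verified with total correctness triples which carry a time
    budget, together with the invariant that all registers and cells have
    absolute value at most V, of order n^3.  An expression of cost k over such
    a state evaluates to at most V^k (eval_bound), so a word size V^20 covers
    every intermediate value. *)

(** * The Moebius function and the summatory identities *)

Definition mu (m : nat) : int :=
  \prod_(p <- primes m) (if logn p m == 1%N then -1 else 0).

Definition mertens (x : nat) : int := \sum_(1 <= d < x.+1) mu d.

Lemma mu1 : mu 1 = 1.
Proof. by rewrite /mu big_nil. Qed.

Lemma mu_abs m : (`|mu m| <= 1)%N.
Proof.
rewrite /mu; elim: (primes m) => [|p s IH]; first by rewrite big_nil.
by rewrite big_cons abszM; case: ifP => _; rewrite ?mul0n // mul1n.
Qed.

Lemma muM_prime p m : prime p -> (0 < m)%N ->
  mu (p * m) = if (p %| m)%N then 0 else - mu m.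
Proof.
move=> p_pr m0; have p0 := prime_gt0 p_pr.
have pm0 : (0 < p * m)%N by rewrite muln_gt0 p0.
have pP : p \in primes (p * m) by rewrite mem_primes p_pr pm0 dvdn_mulr.
have logp : logn p (p * m) = (logn p m).+1.
  by rewrite lognM // (logn_prime _ p_pr) eqxx add1n.
case: ifP => pm.
  rewrite /mu (big_rem p) //= logp eqSS eqn0Ngt.
  by rewrite logn_gt0 mem_primes p_pr m0 pm /= mul0r.
have pN : p \notin primes m by rewrite mem_primes p_pr m0 pm.
have perm : perm_eq (primes (p * m)) (p :: primes m).
  apply: uniq_perm; rewrite ?primes_uniq //= ?primes_uniq ?pN // => q.
  by rewrite primesM // primes_prime // !inE.
rewrite /mu (perm_big _ perm) /= big_cons logp.
have -> : logn p m = 0%N by apply/eqP; rewrite eqn0Ngt logn_gt0 pN.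
rewrite eqxx mulN1r; congr (- _); rewrite !big_seq; apply: eq_bigr => q qm.
rewrite lognM // (logn_prime _ p_pr).
by case: (eqVneq q p) => [qp|_]; [rewrite -qp qm in pN|rewrite add0n].
Qed.


(** Reindexing by d = p e; no bound on e is lost because P confines p e below N. *)
Lemma big_multiples (p N : nat) (P : pred nat) (F : nat -> int) : (0 < p)%N ->
  (forall d, P d -> d < N)%N ->
  \sum_(1 <= d < N | P d && (p %| d)%N) F d =
  \sum_(1 <= e < N | P (p * e)%N) F (p * e)%N.
Proof.
move=> p0 PN; rewrite -big_filter -[RHS]big_filter -(big_map (muln p) xpredT F).
apply: perm_big; apply: uniq_perm.
- by rewrite filter_uniq ?iota_uniq.
- rewrite map_inj_uniq ?filter_uniq ?iota_uniq // => a b /eqP.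
  by rewrite eqn_pmul2l // => /eqP.
move=> d; rewrite mem_filter mem_index_iota; apply/idP/mapP => [|[e]].
  case/andP=> /andP[Pd /dvdnP[e de]] /andP[d0 dN]; exists e; last by rewrite mulnC.
  rewrite mem_filter mem_index_iota mulnC -de Pd /=; nia.
rewrite mem_filter mem_index_iota => /andP[Pe /andP[e0 _]] ->.
by rewrite Pe dvdn_mulr // muln_gt0 p0 e0 (PN _ Pe).
Qed.

(** Pick a prime p dividing m.  The divisors d = p e with p not dividing e
    cancel against the divisors e, and mu vanishes on the remaining ones. *)
Lemma sum_mu_dvd m N : (0 < m <= N)%N ->
  \sum_(1 <= d < N.+1 | (d %| m)%N) mu d = (m == 1%N)%:R.
Proof.
case/andP=> m0 mN; case: (ltngtP m 1%N) => [|m1|->]; first by case: (m) m0.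
  have [p p_pr pm] := pdivP m1; have p0 := prime_gt0 p_pr.
  rewrite (bigID (fun d => p %| d)%N) /= big_multiples // => [|d]; last first.
    by move/(dvdn_leq m0); lia.
  (* A multiple p e has mu (p e) = - mu e if p does not divide e, else 0. *)
  rewrite (bigID (fun e => p %| e)%N) /= big_nat_cond big1 ?add0r; last first.
    by move=> e /and3P[/andP[e0 _] _ pe]; rewrite muM_prime // pe.
  apply/eqP; rewrite addr_eq0 -sumrN; apply/eqP.
  rewrite big_nat_cond [RHS]big_nat_cond; apply: eq_big => [e|e].
    case: (boolP (p %| e)%N) => pe; rewrite ?andbF // !andbT; congr (_ && _).
    by rewrite Gauss_dvd ?pm // prime_coprime.
  by case/and3P=> /andP[e0 _] _ /negPf pe; rewrite muM_prime // pe.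
rewrite big_mkcond big_ltn; last by lia.
rewrite dvd1n mu1 big_nat_cond big1 ?addr0 // => d /andP[/andP[d1 _] _].
by rewrite dvdn1 gtn_eqF.
Qed.

(** With g = gcd(a, b), a = a' g and b = b' g, the lcm is a' b' g; after
    division of m by g^2 this is the product of the coprime squares of a' and b'. *)
Lemma lcm_sqr_dvd a b m : (a ^ 2 %| m)%N -> (b ^ 2 %| m)%N ->
  (lcmn a b ^ 2 %| m)%N.
Proof.
case: (posnP (gcdn a b)) => [/eqP|g0].
  by rewrite -leqn0 leqNgt gcdn_gt0 negb_or -!leqNgt !leqn0 => /andP[/eqP-> /eqP->].
set g := gcdn a b in g0; have /dvdnP[a' aE] : (g %| a)%N by apply: dvdn_gcdl.
have /dvdnP[b' bE] : (g %| b)%N by apply: dvdn_gcdr.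
have cop : coprime a' b'.
  by rewrite /coprime -(eqn_pmul2r g0) mul1n muln_gcdl -aE -bE.
have lcmE : lcmn a b = (a' * b' * g)%N.
  apply/eqP; rewrite -(eqn_pmul2r g0) muln_lcm_gcd; apply/eqP.
  by rewrite [in LHS]aE [in LHS]bE; lia.
move=> am bm; have /dvdnP[m' mE] : (g ^ 2 %| m)%N.
  by apply: dvdn_trans am; apply: dvdn_exp2r; apply: dvdn_gcdl.
have g20 : (0 < g ^ 2)%N by rewrite expn_gt0 g0.
move: am bm; rewrite lcmE aE bE mE !expnMn !dvdn_pmul2r // => am bm.
by rewrite Gauss_dvd ?am // coprimeXl // coprimeXr.
Qed.

(** Let b be the largest integer with b^2 | m.  By maximality and lcm_sqr_dvd,
    d^2 | m holds exactly when d | b, so the sum is the indicator of b = 1. *)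
Lemma sum_mu_sqr m N : (0 < m <= N)%N ->
  \sum_(1 <= d < N.+1 | (d ^ 2 %| m)%N) mu d = (`[< square_free m >])%:R.
Proof.
case/andP=> m0 mN.
pose P b := (b ^ 2 %| m)%N.
have P1 : exists b, P b by exists 1%N; rewrite /P exp1n dvd1n.
have Pub b : P b -> (b <= m)%N.
  by move/(dvdn_leq m0) => h; apply: leq_trans h; case: b => // b; rewrite leq_pmulr.
case: (ex_maxnP P1 Pub) => b Pb bmax.
have b0 : (0 < b)%N.
  by case: b Pb {bmax} => //; rewrite /P exp0n // dvd0n; lia.
have Pdvd d : (d ^ 2 %| m)%N = (d %| b)%N.
  apply/idP/idP => [Pd|db]; last exact: dvdn_trans (dvdn_exp2r _ db) Pb.
  have : P (lcmn d b) by apply: lcm_sqr_dvd.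
  move/bmax => h; apply/lcmn_idPr/eqP; rewrite eqn_leq h dvdn_leq ?dvdn_lcmr //.
  rewrite lcmn_gt0 b0 andbT; case: (d) Pd => //.
  by rewrite exp0n // dvd0n; lia.
rewrite (eq_bigl (fun d => d %| b)%N) // sum_mu_dvd ?b0; last first.
  exact: leq_trans (Pub _ Pb) mN.
congr (_ %:R); congr (nat_of_bool _); apply/eqP/asboolP => [b1|[_ sf]].
  split=> // d d1; rewrite Pdvd b1 dvdn1; lia.
apply/eqP; rewrite eqn_leq b0 andbT leqNgt; apply/negP => b1.
by have := sf b b1; rewrite -/(P b) Pb.
Qed.

Lemma sum_multiples d n : (0 < d)%N ->
  \sum_(1 <= m < n.+1) (d %| m)%N%:R = (n %/ d)%:Z.
Proof. by move=> d0; rewrite divn_count_dvd -natz natr_sum. Qed.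

Lemma sum_upto_quotient d n N : (0 < d)%N -> (n %/ d <= N)%N ->
  \sum_(1 <= k < N.+1) (k * d <= n)%N%:R = (n %/ d)%:Z.
Proof.
move=> d0 qN; rewrite (eq_bigr (fun k => if (k < (n %/ d).+1)%N then 1 else 0)).
  rewrite -big_mkcond -(@big_nat_widen _ _ _ 1%N (n %/ d).+1 N.+1 xpredT) //.
  by rewrite sumr_const_nat subn1 natz.
by move=> k _; rewrite ltnS leq_divRL //; case: leq.
Qed.

(** Sum sum_mu_sqr over m and exchange the two sums: d^2 has floor(n / d^2)
    multiples up to n. *)
Lemma square_free_count_sum n :
  (square_free_count n)%:Z = \sum_(1 <= d < n.+1) mu d * (n %/ d ^ 2)%:Z.
Proof.
rewrite /square_free_count -sum1_count big_mkcond /=.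
rewrite -[X in X%:Z = _]/(\sum_(i <- iota 1 n) _)%N.
have -> : iota 1 n = index_iota 1 n.+1 by rewrite /index_iota subn1.
rewrite -natz natr_sum.
rewrite (eq_big_nat _ _ (F2 := fun m => \sum_(1 <= d < n.+1) mu d * (d ^ 2 %| m)%N%:R)).
  rewrite exchange_big /= !big_nat; apply: eq_bigr => d /andP[d0 _].
  by rewrite -mulr_sumr sum_multiples // expn_gt0 d0.
move=> m /andP[m0 mn]; rewrite ltnS in mn.
have := @sum_mu_sqr m n; rewrite m0 mn => /(_ isT).
rewrite big_mkcond /= => h; transitivity ((`[< square_free m >])%:R : int).
  by case: asbool.
by rewrite -h; apply: eq_bigr => d _; case: ifP; rewrite ?mulr1 ?mulr0.
Qed.

Lemma mertens_widen y N : (y <= N)%N ->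
  mertens y = \sum_(1 <= e < N.+1) mu e * (e <= y)%N%:R.
Proof.
move=> yN; rewrite /mertens (big_nat_widen _ _ N.+1) // big_mkcond /=.
by apply: eq_bigr => e _; rewrite ltnS; case: leq; rewrite ?mulr1 ?mulr0.
Qed.

(** Both sides of sum_(d e <= x) mu(e) = sum_(m <= x) sum_(e | m) mu(e) count
    mu(e) with multiplicity floor(x / e), and the right side keeps only m = 1. *)
Lemma sum_mertens x : (0 < x)%N -> \sum_(1 <= d < x.+1) mertens (x %/ d) = 1.
Proof.
move=> x0.
rewrite (eq_big_nat _ _ (F2 := fun d => \sum_(1 <= e < x.+1) mu e * (d * e <= x)%N%:R)).
  rewrite exchange_big /=.
  rewrite (eq_big_nat _ _ (F2 := fun e => \sum_(1 <= m < x.+1) mu e * (e %| m)%N%:R)).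
    rewrite exchange_big /=.
    rewrite (eq_big_nat _ _ (F2 := fun m => (m == 1%N)%:R)).
      rewrite big_ltn // big_nat_cond big1 ?addr0 // => m /andP[/andP[m1 _] _].
      by rewrite gtn_eqF.
    move=> m /andP[m0 mx]; rewrite -(@sum_mu_dvd m x) ?m0 //.
    rewrite [RHS]big_mkcond /=.
    by apply: eq_bigr => d _; case: ifP; rewrite ?mulr1 ?mulr0.
  move=> e /andP[e0 _]; rewrite -!mulr_sumr sum_multiples // sum_upto_quotient //.
  exact: leq_div.
move=> d /andP[d0 _]; rewrite (@mertens_widen _ x) ?leq_div //.
by apply: eq_bigr => e _; rewrite leq_divRL // mulnC.
Qed.

(** The integer part of the square root of n / i, the x_i of the introduction. *)
Definition qroot (n i : nat) : nat := (\max_(x < n.+1 | x ^ 2 * i <= n) x)%N.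

Lemma leq_qroot n i y : (0 < i)%N -> (y <= qroot n i)%N = (y ^ 2 * i <= n)%N.
Proof.
move=> i0; apply/idP/idP => [yq|yn].
  have qn : (qroot n i ^ 2 * i <= n)%N.
    rewrite /qroot; elim/big_ind: _ => // a b an bn.
    by rewrite /maxn; case: ifP.
  by apply: leq_trans qn; rewrite leq_mul2r leq_sqr yq orbT.
have yn1 : (y < n.+1)%N.
  rewrite ltnS; apply: leq_trans yn.
  by apply: leq_trans (leq_pmulr _ i0); case: (y) => // z; rewrite leq_pmulr.
exact: (@leq_bigmax_cond _ (fun x : 'I_n.+1 => x ^ 2 * i <= n)%N val (Ordinal yn1) yn).
Qed.

(** Both sides are the largest y with y^2 d^2 i <= n. *)
Lemma qroot_div n i d : (0 < i)%N -> (0 < d)%N ->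
  (qroot n i %/ d)%N = qroot n (i * d ^ 2).
Proof.
move=> i0 d0; have h y : (y <= qroot n i %/ d)%N = (y <= qroot n (i * d ^ 2))%N.
  rewrite leq_divRL // !leq_qroot // ?muln_gt0 ?i0 ?expn_gt0 ?d0 //.
  by congr leq; lia.
by apply/eqP; rewrite eqn_leq h leqnn -h leqnn.
Qed.

Lemma qroot_leq n i : (0 < i)%N -> (qroot n i <= n)%N.
Proof.
move=> i0; have := leqnn (qroot n i); rewrite leq_qroot //; apply: leq_trans.
by apply: leq_trans (leq_pmulr _ i0); case: qroot => // z; rewrite leq_pmulr.
Qed.

(** For d > D, floor(n / d^2) is the number of i <= n / (D+1)^2 with
    i d^2 <= n, that is d <= qroot n i; exchanging the sums leaves the values
    of mu between D and qroot n i. *)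
Lemma square_free_count_split n D :
  (square_free_count n)%:Z =
    \sum_(1 <= d < D.+1) mu d * (n %/ d ^ 2)%:Z
    + \sum_(1 <= i < (n %/ D.+1 ^ 2).+1) (mertens (qroot n i) - mertens D).
Proof.
set I := (n %/ _)%N.
pose F d := mu d * (n %/ d ^ 2)%:Z.
have F0 d : (n < d)%N -> F d = 0.
  by move=> nd; rewrite /F divn_small ?mulr0 // -mulnn; nia.
have -> : (square_free_count n)%:Z = \sum_(1 <= d < (n + D).+1) F d.
  rewrite square_free_count_sum (@big_cat_nat _ _ _ n.+1 1%N (n + D).+1) //=; last by lia.
  by rewrite [X in _ = _ + X]big_nat_cond [X in _ = _ + X]big1 ?addr0 // => d /andP[/andP[/F0]].
rewrite (@big_cat_nat _ _ _ D.+1 1%N (n + D).+1) //=; last by lia.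
congr (_ + _).
rewrite (eq_big_nat _ _ (F2 := fun d => \sum_(1 <= i < I.+1) mu d * (i * d ^ 2 <= n)%N%:R)).
  rewrite exchange_big /= !big_nat; apply: eq_bigr => i /andP[i0 iI].
  have Dq : (D < qroot n i)%N.
    by rewrite leq_qroot // mulnC -leq_divRL // expn_gt0.
  have qn := @qroot_leq n i i0.
  rewrite (@mertens_widen (qroot n i) (n + D)); last by lia.
  rewrite (@big_cat_nat _ _ _ D.+1 1%N (n + D).+1) //=; last by lia.
  rewrite [X in X + _ - _](eq_big_nat _ _ (F2 := mu)); last first.
    by move=> d /andP[_ dD]; rewrite (_ : (d <= _)%N) ?mulr1 //; lia.
  rewrite -/(mertens D) addrAC subrr add0r; apply: eq_bigr => d _.
  by rewrite leq_qroot // mulnC.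
move=> d /andP[Dd _]; rewrite -mulr_sumr sum_upto_quotient ?expn_gt0 ?(leq_ltn_trans _ Dd) //.
by apply: leq_div2l; rewrite ?expn_gt0 ?leq_sqr.
Qed.

(** The first sum has arguments x / d <= D, which the segments supply; the
    second has arguments x / d > D, which are entries of the table itself. *)
Lemma mertens_recursion x D : (D < x)%N ->
  mertens x = (1 - \sum_((x %/ D.+1).+1 <= d < x.+1) mertens (x %/ d))
    - \sum_(2 <= d < (x %/ D.+1).+1) mertens (x %/ d).
Proof.
move=> Dx; have x0 : (0 < x)%N by lia.
have q1 : (0 < x %/ D.+1)%N by rewrite divn_gt0.
have qx := leq_div x D.+1.
rewrite -(sum_mertens x0) (@big_cat_nat _ _ _ (x %/ D.+1).+1 1%N x.+1) //= addrK.
by rewrite big_ltn // divn1 addrK.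
Qed.

Lemma absz_sum_leq (F : nat -> int) a b C :
  (forall d, (a <= d < b)%N -> (`|F d| <= C)%N) ->
  (absz (\sum_(a <= d < b) F d)%R <= (b - a) * C)%N.
Proof.
move=> FC; rewrite big_nat -sum_nat_const_nat [X in (_ <= X)%N]big_nat.
elim/big_ind2: _ => // [x1 x2 y1 y2 h1 h2]; lia.
Qed.

Lemma mertens_abs x : (`|mertens x| <= x)%N.
Proof.
have := @absz_sum_leq mu 1 x.+1 1 (fun d _ => mu_abs d).
by rewrite subn1 muln1.
Qed.

(** A pair holds the part r of m not yet factored and the sign u of the part
    removed, with u = 0 once a square is found.  No primality test is needed:
    when all smaller primes have been removed, only a prime d can divide r. *)
Definition sieve_step (d : nat) (ru : nat * int) : nat * int :=
  if (d %| ru.1)%N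
  then ((ru.1 %/ d)%N, if (d %| ru.1 %/ d)%N then 0 else - ru.2) else ru.

(** The state of m after division by 2, ..., b - 1. *)
Definition sieve_value (b m : nat) : nat * int :=
  foldl (fun ru d => sieve_step d ru) (m, 1) (index_iota 2 b).

Lemma sieve_valueS b m : (2 <= b)%N ->
  sieve_value b.+1 m = sieve_step b (sieve_value b m).
Proof.
move=> b2; rewrite /sieve_value /index_iota subSn // -[(b - 2).+1]addn1 iotaD foldl_cat /=.
by rewrite subnKC.
Qed.

(** Unless a square has been found, every prime factor of the remaining part
    is at least b; so if b divides it, b is prime, and removing b changes the
    sign of mu, or shows that mu vanishes when b divides the quotient again. *)
Lemma sieve_valueP b m : (2 <= b)%N -> (0 < m)%N ->
  [/\ (0 < (sieve_value b m).1)%N, ((sieve_value b m).1 %| m)%N,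
      (`|(sieve_value b m).2| <= 1)%N,
      mu m = (sieve_value b m).2 * mu (sieve_value b m).1
    & (sieve_value b m).2 != 0 ->
      forall p, prime p -> (p %| (sieve_value b m).1)%N -> (b <= p)%N].
Proof.
move=> b2 m0; elim: b b2 => // b IH; rewrite leq_eqVlt => /orP[/eqP [<-]|b2].
  by rewrite mul1r; split=> // _ p /prime_gt1.
have {IH} := IH b2; rewrite sieve_valueS // /sieve_step.
case: (sieve_value b m) => r u /= [r0 rm u1 mE sm]; case: ifPn => /= br; last first.
  split=> // u0 p p_pr pr; rewrite ltn_neqAle sm // andbT.
  by apply: contraNneq br => ->.
have b0 : (0 < b)%N by rewrite ltnW.
have [r' rE] := dvdnP br; rewrite rE mulnK //.
have r'0 : (0 < r')%N by move: r0; rewrite rE; case: (r').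
have dvd' : (r' %| m)%N by apply: dvdn_trans rm; rewrite rE dvdn_mulr.
have [u0|u0] := eqVneq u 0.
  have mu0 : mu m = 0 by rewrite mE u0 mul0r.
  by rewrite u0 oppr0 if_same mul0r; split=> //; rewrite eqxx.
have b_pr : prime b.
  have [p p_pr pb] := pdivP b2; have := sm u0 p p_pr (dvdn_trans pb br).
  by rewrite leq_eqVlt ltnNge (dvdn_leq b0 pb) orbF => /eqP->.
have muE : mu r = if (b %| r')%N then 0 else - mu r' by rewrite rE mulnC muM_prime.
split=> //; first by case: ifP; rewrite ?abszN.
  by rewrite mE muE; case: ifP => _ /=; rewrite ?mulr0 ?mul0r // mulrN mulNr.
case: ifPn => [_|br' _ p p_pr pr']; first by rewrite eqxx.
rewrite ltn_neqAle sm ?andbT //; first by apply: contraNneq br' => ->.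
by rewrite rE dvdn_mulr.
Qed.

(** For m <= B^2 the part left after division by 2, ..., B has all its prime
    factors above B, hence is 1 or a prime. *)
Lemma sieve_value_mu B m : (0 < B)%N -> (0 < m <= B ^ 2)%N ->
  mu m = if (2 <= (sieve_value B.+1 m).1)%N
         then - (sieve_value B.+1 m).2 else (sieve_value B.+1 m).2.
Proof.
move=> B0 /andP[m0 mB]; have [] := @sieve_valueP B.+1 m B0 m0.
case: (sieve_value _ _) => r u /= r0 rm u1 -> sm.
have [u0|u0] := eqVneq u 0; first by rewrite u0 mul0r oppr0 if_same.
case: ifPn => [r2|]; last first.
  by rewrite -leqNgt => r1; rewrite (_ : r = 1%N) ?mu1 ?mulr1 //; lia.
have r_pr : prime r.
  have [p p_pr pr] := pdivP r2; have [q rE] := dvdnP pr.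
  have Bp := sm u0 p p_pr pr.
  have [q1|q2] := leqP q 1; first by move: r0; rewrite rE; case: (q) q1 => [|[|]] //; rewrite mul1n.
  have [p' p'_pr p'q] := pdivP q2.
  have Bp' : (B < p')%N by apply: (sm u0) => //; rewrite rE dvdn_mulr.
  have : (r <= B ^ 2)%N by apply: leq_trans mB; apply: dvdn_leq.
  have qp' : (p' <= q)%N by apply: dvdn_leq => //; exact: ltnW.
  rewrite rE -mulnn; nia.
by rewrite -{1}(muln1 r) muM_prime // dvdn1 gtn_eqF // mu1 mulrN1.
Qed.

(** The d' giving the same quotient v as d extend exactly to x / v. *)
Lemma divn_constant x d (v := (x %/ d)%N) : (0 < d <= x)%N ->
  [/\ (0 < v)%N, (d <= x %/ v)%N,
      forall d', (d <= d' <= x %/ v)%N -> (x %/ d' = v)%N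
    & (x %/ (x %/ v).+1 < v)%N].
Proof.
move=> /andP[d0 dx]; have v0 : (0 < v)%N by rewrite divn_gt0.
split=> //; first by rewrite leq_divRL // mulnC leq_divM.
  move=> d' /andP[dd' d'v]; apply/eqP; rewrite eqn_leq leq_div2l //=.
  rewrite leq_divRL ?(leq_trans d0) // mulnC.
  by apply: leq_trans (leq_divM x v); rewrite leq_mul2r d'v orbT.
by rewrite ltn_divLR // mulnC ltn_ceil.
Qed.

Lemma sum_divn_constant (F : nat -> int) x d (v := (x %/ d)%N) : (0 < d <= x)%N ->
  \sum_(d <= d' < (x %/ v).+1) F (x %/ d')%N = F v * ((x %/ v).+1 - d)%N%:Z.
Proof.
move=> dx; have [_ _ h _] := divn_constant dx.
rewrite (eq_big_nat _ _ (F2 := fun=> F v)) => [|d' /h -> //].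
by rewrite sumr_const_nat -mulr_natr natz.
Qed.

(** * Triples with a time budget *)

(** Bounds the cost of each expression of the program, hence the exponent in
    the word size. *)
Definition max_cost : nat := 20.
(** Bounds the time of each loop-free piece of the program. *)
Definition block_time : nat := 100.

Definition bounded (V : nat) (s : state) : Prop :=
  (forall r, `|regs s r| <= V)%N /\ (forall a, `|cells s a| <= V)%N.

(** Constants up to 2 never exceed the bound V > 1 on registers and cells. *)
Fixpoint small_consts (e : expr) : bool :=
  match e with
  | Const z => (`|z| <= 2)%N
  | Reg _ => true
  | Read a => small_consts a
  | Bin _ e1 e2 => small_consts e1 && small_consts e2
  end.

Fixpoint reads_ok (mem : nat) (s : state) (e : expr) : bool :=
  match e with
  | Const _ | Reg _ => true
  | Read a => reads_ok mem s a && address mem (eval_expr s a)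
  | Bin _ e1 e2 => reads_ok mem s e1 && reads_ok mem s e2
  end.

Fixpoint no_reads (e : expr) : bool :=
  match e with
  | Const _ | Reg _ => true
  | Read _ => false
  | Bin _ e1 e2 => no_reads e1 && no_reads e2
  end.

Definition small (e : expr) : bool := small_consts e && (cost e <= max_cost)%N.

Lemma cost_gt0 e : (0 < cost e)%N.
Proof. by case: e. Qed.

(** For X, Y >= 2 both X + Y and X Y are at most X Y, and quotients and
    remainders do not exceed their operands. *)
Lemma eval_bound V s e : (1 < V)%N -> bounded V s -> small_consts e ->
  (`|eval_expr s e| <= V ^ cost e)%N.
Proof.
move=> V1 [Vr Vc]; elim: e => [z|r|a IH|o e1 IH1 e2 IH2] /=.
- by move/leq_trans; apply; rewrite expn1.
- by rewrite expn1.
- move=> _; apply: leq_trans (Vc _) _; rewrite expnS leq_pmulr //.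
  by rewrite expn_gt0 ltnW.
case/andP=> /IH1 h1 /IH2 h2.
have V0 : (0 < V)%N by rewrite ltnW.
have p1 : (2 <= V ^ cost e1)%N.
  by apply: leq_trans V1 _; rewrite -{1}(expn1 V) leq_pexp2l ?cost_gt0.
have p2 : (2 <= V ^ cost e2)%N.
  by apply: leq_trans V1 _; rewrite -{1}(expn1 V) leq_pexp2l ?cost_gt0.
rewrite expnS expnD.
move: (eval_expr s e1) (eval_expr s e2) (V ^ cost e1)%N (V ^ cost e2)%N h1 h2 p1 p2.
move=> x y X Y xX yY X2 Y2.
have XY : (2 * (X * Y) <= V * (X * Y))%N by rewrite leq_mul2r V1 orbT.
apply: leq_trans XY.
have sXY : (X + Y <= X * Y)%N by nia.
case: o => /=.
- lia.
- lia.
- by rewrite abszM; nia.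
- have : (`|(x %/ y)%Z| <= `|x|)%N.
    have sy : (`|sgz y| <= 1)%N by case: (sgzP y).
    case: x {xX} => m; rewrite /divz abszM /= ?abszN.
      by apply: leq_trans (leq_mul sy (leq_div m _)) _; rewrite mul1n.
    apply: leq_trans (leq_mul sy (leqnn _)) _.
    by rewrite mul1n ltnS leq_div.
  nia.
- have : (`|(x %% y)%Z| <= maxn `|x| `|y|)%N.
    have [->|y0] := eqVneq y 0; first by rewrite modz0 leq_maxl.
    by move: (modz_ge0 x y0) (ltz_mod x y0); lia.
  nia.
- by case: ifP => _ /=; nia.
- by case: ifP => _ /=; nia.
Qed.

Lemma safe_small V mem s e : (1 < V)%N -> bounded V s -> small e ->
  reads_ok mem s e -> safe (V ^ max_cost) mem s e.
Proof.
move=> V1 bs; rewrite /small.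
have vb e' : small_consts e' -> (cost e' <= max_cost)%N ->
    (`|eval_expr s e'| <= V ^ max_cost)%N.
  move=> sc ct; apply: leq_trans (eval_bound V1 bs sc) _.
  by rewrite leq_pexp2l // ltnW.
elim: e => [z|r|a IH|o e1 IH1 e2 IH2] /andP[sc ct] ro;
  rewrite -[safe _ _ _ _]/(_ && _) vb //=.
- case/andP: ro => ra ->; rewrite andbT; apply: IH => //.
  by apply/andP; split; [exact: sc|exact: ltnW].
- case/andP: sc => s1 s2; case/andP: ro => r1 r2; move: ct => /= ct.
  by apply/andP; split; [apply: IH1|apply: IH2] => //; apply/andP; split => //; lia.
Qed.

Section Triple.
Variables (V mem : nat).
Hypothesis V_gt1 : (1 < V)%N.

(** From s, the command c terminates within T units of time in a state that
    satisfies Q; that values stay below V is assumed at the start and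
    re-established at the end. *)
Definition triple (c : cmd) (s : state) (T : nat) (Q : state -> Prop) : Prop :=
  bounded V s -> exists t s',
    [/\ exec (V ^ max_cost) mem c s t s', (t <= T)%N, bounded V s' & Q s'].

Lemma triple_weaken c s T T' (Q Q' : state -> Prop) : (T <= T')%N ->
  (forall s', Q s' -> Q' s') -> triple c s T Q -> triple c s T' Q'.
Proof.
move=> TT QQ h /h[t [s' [ex tT bs /QQ Qs]]]; exists t, s'.
by split=> //; apply: leq_trans TT.
Qed.

Lemma triple_seq c1 c2 s T1 T2 Q :
  triple c1 s T1 (fun s' => triple c2 s' T2 Q) -> triple (Seq c1 c2) s (T1 + T2) Q.
Proof.
move=> h1 /h1[t1 [s1 [ex1 l1 bs1 h2]]]; have [t2 [s2 [ex2 l2 bs2 Qs]]] := h2 bs1.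
exists (t1 + t2)%N, s2; split=> //; last exact: leq_add.
exact: exec_Seq ex1 ex2.
Qed.

(** Weakest preconditions of loop-free commands.  Only assigned and stored
    values must be at most V; intermediate ones are covered by eval_bound. *)
Fixpoint wp (c : cmd) (s : state) (Q : state -> Prop) : Prop :=
  match c with
  | Skip => Q s
  | Assign r e =>
      [/\ reads_ok mem s e, (`|eval_expr s e| <= V)%N
        & Q (set_reg s r (eval_expr s e))]
  | Write a e =>
      [/\ reads_ok mem s a, reads_ok mem s e, address mem (eval_expr s a),
          (`|eval_expr s e| <= V)%N
        & Q (set_cell s (eval_expr s a) (eval_expr s e))]
  | Seq c1 c2 => wp c1 s (fun s' => wp c2 s' Q)
  | If e c1 c2 =>
      reads_ok mem s e /\
      if eval_expr s e == 0 then wp c2 s Q else wp c1 s Q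
  | While _ _ => False
  end.

Fixpoint smalls (c : cmd) : bool :=
  match c with
  | Skip => true
  | Assign _ e => small e
  | Write a e => small a && small e
  | Seq c1 c2 => smalls c1 && smalls c2
  | If e c1 c2 => [&& small e, smalls c1 & smalls c2]
  | While _ _ => false
  end.

Fixpoint straight_time (c : cmd) : nat :=
  match c with
  | Skip => 0
  | Assign _ e => (cost e).+1
  | Write a e => (cost a + cost e).+1
  | Seq c1 c2 => straight_time c1 + straight_time c2
  | If e c1 c2 => (cost e + maxn (straight_time c1) (straight_time c2)).+1
  | While _ _ => 0
  end.

Lemma bounded_set_reg s r v : bounded V s -> (`|v| <= V)%N ->
  bounded V (set_reg s r v).
Proof. by case=> br bc bv; split=> //= r'; case: eqP. Qed.

Lemma bounded_set_cell s a v : bounded V s -> (`|v| <= V)%N ->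
  bounded V (set_cell s a v).
Proof. by case=> br bc bv; split=> //= r'; case: eqP. Qed.

Lemma wp_straight c s Q : smalls c -> wp c s Q -> triple c s (straight_time c) Q.
Proof.
elim: c s Q => [|r e|a e|c1 IH1 c2 IH2|e c1 IH1 c2 IH2|//] s Q /= sm.
- by move=> Qs bs; exists 0%N, s; split=> //; exact: exec_Skip.
- case=> ro ev Qs bs; do 2![eexists]; split; [|exact: leqnn| |exact: Qs].
    exact/exec_Assign/safe_small.
  exact: bounded_set_reg.
- case/andP: sm => sa se [ra re ad ev Qs] bs; do 2![eexists].
  split; [|exact: leqnn| |exact: Qs].
    by apply: exec_Write => //; apply: safe_small.
  exact: bounded_set_cell.
- case/andP: sm => s1 s2 w; apply: triple_seq.
  by apply: triple_weaken (leqnn _) _ (IH1 _ _ s1 w) => s' /(IH2 _ _ s2).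
- case/and3P: sm => se s1 s2 [ro]; case: eqVneq => [e0|e0] w bs.
    have [t [s' [ex l bs' Qs]]] := IH2 _ _ s2 w bs.
    exists (cost e + t).+1, s'; split=> //; last by lia.
    exact: exec_IfFalse (safe_small V_gt1 bs se ro) e0 ex.
  have [t [s' [ex l bs' Qs]]] := IH1 _ _ s1 w bs.
  exists (cost e + t).+1, s'; split=> //; last by lia.
  exact: exec_IfTrue (safe_small V_gt1 bs se ro) e0 ex.
Qed.

Definition block (c : cmd) : bool := smalls c && (straight_time c <= block_time)%N.

Lemma triple_block c s Q : block c -> wp c s Q -> triple c s block_time Q.
Proof. by case/andP=> sc tc /(wp_straight sc); apply: triple_weaken. Qed.

Definition guard (e : expr) : bool := small e && no_reads e.

Lemma no_reads_ok s e : no_reads e -> reads_ok mem s e.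
Proof. by elim: e => //= o e1 IH1 e2 IH2 /andP[/IH1-> /IH2->]. Qed.

Definition step_time : nat := max_cost.+1.

(** The invariant is indexed by a potential p, from which the cost of each
    iteration is paid. *)
Lemma triple_while e c (Inv : nat -> state -> Prop) : guard e ->
  (forall p s, Inv p s -> eval_expr s e != 0 ->
    exists F, triple c s F
      (fun s' => exists p', Inv p' s' /\ (p' + F + step_time <= p)%N)) ->
  forall p s, Inv p s -> triple (While e c) s (p + step_time)
    (fun s' => exists2 p', Inv p' s' & eval_expr s' e = 0).
Proof.
case/andP=> se /no_reads_ok ro body p s; have [k] := ubnP p.
elim: k p s => // k IH p s Pk Is bs.
have sf := safe_small V_gt1 bs se (ro s).
have ce : (cost e < step_time)%N by case/andP: se.
have [e0|e0] := eqVneq (eval_expr s e) 0.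
  exists (cost e).+1, s; split=> //; [exact: exec_WhileFalse|lia|by exists p].
have [F hF] := body p s Is e0.
have [t1 [s1 [ex1 l1 bs1 [p1 [I1 P1]]]]] := hF bs.
have P1k : (p1 < k)%N by move: Pk P1; rewrite /step_time; lia.
have [t2 [s2 [ex2 l2 bs2 Q2]]] := IH p1 s1 P1k I1 bs1.
exists (cost e + t1 + t2).+1, s2; split=> //; last by lia.
exact: exec_WhileTrue sf e0 ex1 ex2.
Qed.

(** For loops with a known number of iterations, whose time may depend on
    the counter. *)
Lemma triple_for e c (Inv : nat -> state -> Prop) (f : nat -> nat) a b : guard e ->
  (a <= b)%N ->
  (forall k s, (a <= k < b)%N -> Inv k s ->
     eval_expr s e != 0 /\ triple c s (f k) (Inv k.+1)) ->
  (forall s, Inv b s -> eval_expr s e = 0) ->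
  forall s, Inv a s ->
  triple (While e c) s (\sum_(a <= k < b) (f k + step_time) + step_time)%N (Inv b).
Proof.
case/andP=> se /no_reads_ok ro ab body stop.
have [m mE] : {m | b = a + m}%N by exists (b - a)%N; lia.
elim: m a mE {ab} body => [|m IH] a mE body s Is bs.
  rewrite mE addn0 in stop *; rewrite big_geq // add0n.
  exists (cost e).+1, s; split=> //; last by case/andP: se.
  by apply: exec_WhileFalse (stop _ Is); apply: safe_small.
have ak : (a <= a < b)%N by lia.
have [e0 h1] := body a s ak Is.
have [t1 [s1 [ex1 l1 bs1 I1]]] := h1 bs.
have [||t2 [s2 [ex2 l2 bs2 Q2]]] := IH a.+1 _ _ s1 I1 bs1; first by lia.
  by move=> k s' ks'; apply: body; lia.
exists (cost e + t1 + t2).+1, s2; split=> //.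
  by apply: exec_WhileTrue ex1 ex2 => //; apply: safe_small.
have ce : (cost e < step_time)%N by case/andP: se.
by rewrite big_ltn; lia.
Qed.
End Triple.

Fixpoint assigned (c : cmd) : seq nat :=
  match c with
  | Skip | Write _ _ => [::]
  | Assign r _ => [:: r]
  | Seq c1 c2 | If _ c1 c2 => assigned c1 ++ assigned c2
  | While _ c => assigned c
  end.

Fixpoint no_writes (c : cmd) : bool :=
  match c with
  | Skip | Assign _ _ => true
  | Write _ _ => false
  | Seq c1 c2 | If _ c1 c2 => no_writes c1 && no_writes c2
  | While _ c => no_writes c
  end.

Lemma exec_regs word mem c s t s' r : exec word mem c s t s' ->
  r \notin assigned c -> regs s' r = regs s r.
Proof.
elim=> {c s t s'} //=.
- by move=> s r' e _; rewrite inE => /negPf->.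
- move=> c1 c2 s1 s2 s3 t1 t2 _ IH1 _ IH2.
  by rewrite mem_cat negb_or => /andP[/IH1 <- /IH2].
- by move=> e c1 c2 s s' t _ _ _ IH; rewrite mem_cat negb_or => /andP[/IH].
- by move=> e c1 c2 s s' t _ _ _ IH; rewrite mem_cat negb_or => /andP[_ /IH].
- by move=> e c s1 s2 s3 t1 t2 _ _ _ IH1 _ IH2 rc; rewrite IH2 ?IH1.
Qed.

Lemma exec_cells word mem c s t s' : exec word mem c s t s' ->
  no_writes c -> cells s' = cells s.
Proof.
elim=> {c s t s'} //=.
- by move=> c1 c2 s1 s2 s3 t1 t2 _ IH1 _ IH2 /andP[/IH1 <- /IH2].
- by move=> e c1 c2 s s' t _ _ _ IH /andP[/IH].
- by move=> e c1 c2 s s' t _ _ _ IH /andP[_ /IH].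
- by move=> e c s1 s2 s3 t1 t2 _ _ _ IH1 _ IH2 rc; rewrite IH2 ?IH1.
Qed.

(** Registers to which c never assigns are preserved; this lets specifications
    mention only what a command changes. *)
Definition frame (c : cmd) (s s' : state) : Prop :=
  forall r, r \notin assigned c -> regs s' r = regs s r.

Lemma triple_frame V mem c s T Q : triple V mem c s T Q ->
  triple V mem c s T (fun s' => Q s' /\ frame c s s').
Proof.
move=> h /h[t [s' [ex l bs Qs]]]; exists t, s'; split=> //; split=> // r.
exact: exec_regs ex.
Qed.

Lemma triple_cells V mem c s T Q : no_writes c -> triple V mem c s T Q ->
  triple V mem c s T (fun s' => Q s' /\ cells s' = cells s).
Proof.
move=> nw h /h[t [s' [ex l bs Qs]]]; exists t, s'; split=> //; split=> //.
exact: exec_cells ex nw.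
Qed.

(** * The program and its correctness *)

Local Notation "! r" := (Reg r) (at level 9, r at level 8, format "! r").
Local Notation "e1 [+] e2" := (Bin Add e1 e2) (at level 50, left associativity).
Local Notation "e1 [-] e2" := (Bin Defs.Sub e1 e2) (at level 50, left associativity).
Local Notation "e1 [*] e2" := (Bin Mul e1 e2) (at level 40, left associativity).
Local Notation "e1 [/] e2" := (Bin Div e1 e2) (at level 40, left associativity).
Local Notation "e1 [%] e2" := (Bin Mod e1 e2) (at level 40, left associativity).
Local Notation "e1 [=] e2" := (Bin Eq e1 e2) (at level 70, no associativity).
Local Notation "e1 [<=] e2" := (Bin Le e1 e2) (at level 70, no associativity).
Local Notation "r ::= e" := (Assign r e) (at level 75, no associativity).
Local Notation "c1 ;; c2" := (Seq c1 c2) (at level 80, right associativity).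
Local Notation zero := (Const (Posz 0)).
Local Notation one := (Const (Posz 1)).
Local Notation two := (Const (Posz 2)).

(** Registers: lo is the last integer before the current segment; rM and rS
    hold M(lo) and the sum of mu(d) floor(n / d^2) over d <= lo, and inside a
    segment the same sums up to the current integer.  The contribution of the
    d > B^2 is added to rS at the end. *)
Local Notation rn := 0%N.
Local Notation rB := 1%N.
Local Notation rI := 2%N.
Local Notation ri := 3%N.
Local Notation rx := 4%N.
Local Notation rs := 5%N.
Local Notation rl := 6%N.
Local Notation rM := 7%N.
Local Notation rS := 8%N.
Local Notation rk := 9%N.
Local Notation rd := 10%N.
Local Notation rr := 11%N.
Local Notation re := 12%N.
Local Notation ra := 13%N.
Local Notation rv := 14%N.
Local Notation rt := 15%N.

(** Memory: cells 0 to B-1 hold the unfactored parts of lo+1, ..., lo+B, and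
    cells B to 2B-1 the signs, later replaced by values of M; cells 2B+i and
    3B+i hold the running value for M(x_i) and x_i. *)
Local Notation acc_at e := (!rB [+] !rB [+] e).
Local Notation root_at e := (!rB [+] !rB [+] !rB [+] e).

(** Sets B to the least integer with n < B^5. *)
Definition find_base : cmd :=
  rB ::= one ;;
  While (!rB [*] !rB [*] !rB [*] !rB [*] !rB [<=] !rn) (rB ::= !rB [+] one).

Definition search_root : cmd :=
  While ((!rx [+] !rs) [*] (!rx [+] !rs) [*] !ri [<=] !rn) (rx ::= !rx [+] !rs).

(** Three searches with steps B^2, B and 1 find the root x_i < B^3 digit by
    digit in base B, in O(B) steps and without any root extraction. *)
Definition root_body : cmd :=
  (rx ::= zero ;; rs ::= !rB [*] !rB) ;; search_root ;;
  rs ::= !rB ;; search_root ;;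
  rs ::= one ;; search_root ;;
  (Write (root_at !ri) !rx ;; Write (acc_at !ri) one ;; ri ::= !ri [+] one).

Definition find_roots : cmd :=
  (rI ::= !rn [/] ((!rB [*] !rB [+] one) [*] (!rB [*] !rB [+] one)) ;;
   ri ::= one) ;;
  While (!ri [<=] !rI) root_body.

Definition init_segment : cmd :=
  rk ::= zero ;;
  While (!rk [+] one [<=] !rB)
    (Write !rk (!rl [+] one [+] !rk) ;; Write (!rB [+] !rk) one ;;
     rk ::= !rk [+] one).

Definition sieve_cell : cmd :=
  rr ::= Read !rk ;;
  If (!rr [%] !rd [=] zero)
    (rr ::= !rr [/] !rd ;; Write !rk !rr ;;
     If (!rr [%] !rd [=] zero)
       (Write (!rB [+] !rk) zero)
       (Write (!rB [+] !rk) (zero [-] Read (!rB [+] !rk))))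
    Skip ;;
  rk ::= !rk [+] !rd.

(** The first multiple of d in the segment is at offset -(lo+1) mod d. *)
Definition sieve_by : cmd :=
  rk ::= (zero [-] (!rl [+] one)) [%] !rd ;;
  While (!rk [+] one [<=] !rB) sieve_cell ;;
  rd ::= !rd [+] one.

Definition sieve : cmd := rd ::= two ;; While (!rd [<=] !rB) sieve_by.

Definition prefix_sums : cmd :=
  rk ::= zero ;;
  While (!rk [+] one [<=] !rB)
    (rt ::= !rl [+] one [+] !rk ;;
     rv ::= Read (!rB [+] !rk) ;;
     If (two [<=] Read !rk) (rv ::= zero [-] !rv) Skip ;;
     rM ::= !rM [+] !rv ;;
     rS ::= !rS [+] !rv [*] (!rn [/] (!rt [*] !rt)) ;;
     Write (!rB [+] !rk) !rM ;;
     rk ::= !rk [+] one).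

(** Treats together all the d' from d to t = x / v with quotient v = x / d. *)
Definition group_body : cmd :=
  rv ::= !rx [/] !rd ;;
  rt ::= !rx [/] !rv ;;
  ra ::= !ra [-] Read (!rB [+] (!rv [-] !rl [-] one)) [*] (!rt [+] one [-] !rd) ;;
  rd ::= !rt [+] one.

(** The quotients x / d between lo+1 and lo+B are those with
    x / (lo+B+1) < d <= x / (lo+1). *)
Definition gather_body : cmd :=
  (rx ::= Read (root_at !ri) ;;
   rd ::= !rx [/] (!rl [+] !rB [+] one) [+] one ;;
   re ::= !rx [/] (!rl [+] one) ;;
   ra ::= Read (acc_at !ri)) ;;
  While (!rd [<=] !re) group_body ;;
  (Write (acc_at !ri) !ra ;; ri ::= !ri [+] one).

Definition gather : cmd := ri ::= one ;; While (!ri [<=] !rI) gather_body.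

Definition segment : cmd :=
  init_segment ;; sieve ;; prefix_sums ;; gather ;; rl ::= !rl [+] !rB.

Definition all_segments : cmd :=
  (rM ::= zero ;; rS ::= zero ;; rl ::= zero) ;;
  While (!rl [+] one [<=] !rB [*] !rB) segment.

Definition combine_body : cmd :=
  (ra ::= Read (acc_at !ri) ;; rd ::= two) ;;
  While (!ri [*] !rd [*] !rd [<=] !rI)
    (ra ::= !ra [-] Read (acc_at (!ri [*] !rd [*] !rd)) ;;
     rd ::= !rd [+] one) ;;
  (Write (acc_at !ri) !ra ;; rS ::= !rS [+] (!ra [-] !rM) ;;
   ri ::= !ri [-] one).

Definition combine : cmd := ri ::= !rI ;; While (one [<=] !ri) combine_body.

Definition square_free_program : cmd :=
  find_base ;; find_roots ;; all_segments ;; combine ;; rn ::= !rS.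

Lemma guardE (b : bool) : ((if b then 1%Z else 0%Z) != 0) = b.
Proof. by case: b. Qed.

Lemma guardN (b : bool) : (if b then 1%Z else 0%Z) = 0 -> ~~ b.
Proof. by case: b. Qed.

Lemma sqr_leq x i n : (0 < i)%N -> (x ^ 2 * i <= n)%N -> (x <= n)%N.
Proof. by move=> i0; rewrite -leq_qroot // => /leq_trans; apply; apply: qroot_leq. Qed.

Lemma qroot_unique n i x : (0 < i)%N ->
  (x ^ 2 * i <= n < (x + 1) ^ 2 * i)%N -> x = qroot n i.
Proof.
move=> i0; rewrite addn1 ltnNge -!leq_qroot // => /andP[h1 h2].
by apply/eqP; rewrite eqn_leq h1 leqNgt.
Qed.

Lemma addr_nat m p : address m p%:Z = (p < m)%N.
Proof. by rewrite /address ltz_nat. Qed.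

Lemma triple_keep V mem c s T Q : no_writes c -> triple V mem c s T Q ->
  triple V mem c s T (fun s' => [/\ Q s', frame c s s' & cells s' = cells s]).
Proof.
move=> nw /triple_frame /(triple_cells nw).
by apply: triple_weaken => // s' [[]].
Qed.

Lemma triple_for_const V mem e c (Inv : nat -> state -> Prop) (F : nat) a b :
  (1 < V)%N -> guard e -> (a <= b)%N ->
  (forall k s, (a <= k < b)%N -> Inv k s ->
     eval_expr s e != 0 /\ triple V mem c s F (Inv k.+1)) ->
  (forall s, Inv b s -> eval_expr s e = 0) ->
  forall s, Inv a s ->
  triple V mem (While e c) s ((b - a) * (F + step_time) + step_time)%N (Inv b).
Proof.
move=> V1 ge ab body stop s Is; rewrite -sum_nat_const_nat.
exact: (triple_for V1 (f := fun=> F)).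
Qed.

Lemma testE (b : bool) (P Q : Prop) :
  (if (if b then 1%R else 0%R : int) == 0 then P else Q) = (if b then Q else P).
Proof. by case: b. Qed.

(** The remainder of -m completes m to a multiple of d. *)
Lemma neg_modz (m d : nat) : (0 < d)%N ->
  exists2 k : nat, ((0%Z - m%:Z) %% d%:Z)%Z = k%:Z & (k < d)%N && (d %| m + k)%N.
Proof.
move=> d0; have dz : d%:Z != 0 by rewrite eqz_nat -lt0n.
set z := (_ %% _)%Z.
have zE : `|z|%N%:Z = z by rewrite gez0_abs ?modz_ge0.
exists `|z|%N => //; apply/andP; split.
  by have := ltz_mod (0%Z - m%:Z) dz; rewrite -/z -zE; lia.
have := divz_eq (0%Z - m%:Z) d%:Z; rewrite -/z -{1}zE => h.
have : (d%:Z %| (m + `|z|%N)%:Z)%Z.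
  apply/dvdzP; exists (- ((0%Z - m%:Z) %/ d%:Z)%Z).
  by rewrite mulNr PoszD; move: h; lia.
by rewrite dvdzE.
Qed.

(** Passing to the next block lowers both the quotient and the number of
    divisors left, so their minimum is a valid loop variant. *)
Lemma minn_decreases u v lo t d e : (u < v)%N -> (lo < v)%N -> (d <= t)%N ->
  (t <= e)%N -> (minn (u - lo) (e.+1 - t.+1) < minn (v - lo) (e.+1 - d))%N.
Proof. lia. Qed.

Ltac run_block := apply: triple_block; [assumption | by [] | rewrite /=].

Section Program.
Variables (n B V N I mem : nat).
Hypothesis V_gt1 : (1 < V)%N.
Hypothesis n_gt0 : (0 < n)%N.
Hypothesis B_gt0 : (0 < B)%N.
Hypothesis nB : (n < B ^ 5)%N.
Hypothesis Bn : (B.-1 ^ 5 <= n)%N.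
(* N, I and mem are variables constrained by equations, so that arithmetic
   goals treat them as atoms. *)
Hypothesis NE : N = n.+2.
Hypothesis V_big : (8 * (N * N * N) <= V)%N.
Hypothesis IE : I = (n %/ (B ^ 2).+1 ^ 2)%N.
Hypothesis memE : mem = (4 * B)%N.

(** N is an upper bound for B and for n + 1, in terms of which the bound V on
    stored values is expressed. *)
Lemma leB_N : (B < N)%N.
Proof.
suff : (B.-1 <= n)%N by rewrite NE; lia.
apply: leq_trans Bn; case: (B.-1) => // b; rewrite -[X in (X <= _)%N]expn1.
by rewrite leq_pexp2l.
Qed.

Lemma N_V : [/\ N <= V, N * N <= V & 7 * (N * N * N) <= V]%N.
Proof. by move: V_big; rewrite NE; split; nia. Qed.

Lemma n_V : (n <= V)%N.
Proof. by have [h _ _] := N_V; rewrite NE in h; lia. Qed.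

(** The distance to the upper bound x0 + h B drops by h at each step, hence
    at most B steps. *)
Lemma triple_search s i x0 h :
  regs s rn = n%:Z -> regs s ri = i%:Z -> regs s rx = x0%:Z -> regs s rs = h%:Z ->
  (0 < i)%N -> (0 < h)%N ->
  (x0 ^ 2 * i <= n < (x0 + h * B) ^ 2 * i)%N ->
  triple V mem search_root s ((block_time + step_time) * B + step_time)%N
   (fun s' => exists2 x : nat, regs s' rx = x%:Z & (x ^ 2 * i <= n < (x + h) ^ 2 * i)%N).
Proof.
move=> sn si sx sh i0 h0 /andP[x0n nx0].
pose Inv (p : nat) (s : state) := exists2 x : nat,
 [/\ regs s rn = n%:Z, regs s ri = i%:Z, regs s rx = x%:Z & regs s rs = h%:Z] &
 exists j, [/\ p = ((block_time + step_time) * j)%N, (x ^ 2 * i <= n)%N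
             & (n < (x + h * j) ^ 2 * i)%N].
apply: (triple_weaken (leqnn _)); last first.
  apply: (triple_while V_gt1 (Inv := Inv)) => //.
    move=> p s' [x [en ei ex es] [j [-> xn nx]]].
    rewrite /= ex es ei en -!PoszD -!PoszM lez_nat guardE mulnn => xhn.
    exists block_time; run_block.
    have xhV := leq_trans (sqr_leq i0 xhn) n_V.
    rewrite /= ex es -PoszD; split=> //.
    have j0 : (0 < j)%N.
      by case: j nx => // nx; move: nx xn; rewrite muln0 addn0; lia.
    exists ((block_time + step_time) * j.-1)%N; split; last first.
      by rewrite -addnA -mulnSr prednK.
    exists (x + h)%N => //; exists j.-1; split=> //.
    by rewrite -addnA -mulnS prednK.
  by exists x0 => //; exists B; split.
move=> s' [p [x [en ei ex es] [j [_ xn nx]]]].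
rewrite /= ex es ei en -!PoszD -!PoszM lez_nat => /guardN; rewrite -ltnNge => h1.
by exists x => //; rewrite xn -mulnn.
Qed.

Lemma triple_find_base s : regs s rn = n%:Z ->
  triple V mem find_base s
    (block_time + ((B - 1) * (block_time + step_time) + step_time))%N
    (fun s' => regs s' rn = n%:Z /\ regs s' rB = B%:Z).
Proof.
move=> sn; apply: triple_seq; run_block; split=> //.
  by rewrite ltnW.
apply: (triple_for_const V_gt1 (Inv := fun k s => regs s rn = n%:Z /\ regs s rB = k%:Z)) => //.
- move=> k s' kB [en ek]; rewrite /= en ek -!PoszM lez_nat guardE; split.
    apply: leq_trans Bn; rewrite -[(_ * _ * _ * _ * _)%N]/((k ^ 1 * k * k * k * k)%N).
    by rewrite -!expnSr leq_exp2r //; lia.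
  run_block; rewrite ek; split=> //; last by split=> //; rewrite -PoszD addn1.
  by have := leB_N; have [h _ _] := N_V; lia.
- move=> s' [en eB]; rewrite /= en eB -!PoszM lez_nat leqNgt.
  by rewrite (_ : (B * B * B * B * B)%N = B ^ 5)%N ?nB // !expnS expn0 muln1 !mulnA.
Qed.

(** The running value for M(x_i) once the segments up to lo are processed:
    1 minus the terms M(x_i / d) with x_i / d <= lo. *)
Definition acc i lo : int :=
  1 - \sum_((qroot n i %/ lo.+1).+1 <= d < (qroot n i).+1) mertens (qroot n i %/ d).

Lemma acc0 i : acc i 0 = 1.
Proof. by rewrite /acc divn1 big_geq ?subr0. Qed.

Definition env (s : state) : Prop :=
  [/\ regs s rn = n%:Z, regs s rB = B%:Z & regs s rI = I%:Z].

Definition entry (lo i : nat) (s : state) : Prop :=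
  cells s (B + B + B + i)%N%:Z = (qroot n i)%:Z /\
  cells s (B + B + i)%N%:Z = acc i lo.

Lemma ltI_B : (I < B)%N.
Proof.
rewrite IE ltn_divLR ?expn_gt0 //; apply: leq_trans nB _.
rewrite expnS -[X in (_ ^ X)%N]/(2 * 2)%N expnM leq_mul2l; apply/orP; right.
by rewrite leq_exp2r.
Qed.

(** The four blocks of cells fit in memory because I < B. *)
Lemma root_addr i : (i <= I)%N -> (B + B + B + i < mem)%N.
Proof. by have := ltI_B; rewrite memE; lia. Qed.

Lemma acc_addr i : (i <= I)%N -> (B + B + i < mem)%N.
Proof. by have := ltI_B; rewrite memE; lia. Qed.

Lemma ltB_V : (B < V)%N.
Proof. by have [h _ _] := N_V; apply: leq_trans leB_N h. Qed.

Definition search_time : nat := ((block_time + step_time) * B + step_time)%N.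

Definition root_time : nat :=
  (block_time + (search_time + (block_time + (search_time + (block_time +
    (search_time + block_time))))))%N.

Lemma triple_root_body s i : env s -> regs s ri = i%:Z -> (0 < i <= I)%N ->
  (forall j, (0 < j < i)%N -> entry 0 j s) ->
  triple V mem root_body s root_time (fun s' =>
    [/\ env s', regs s' ri = i.+1%:Z & forall j, (0 < j < i.+1)%N -> entry 0 j s']).
Proof.
move=> [sn sB sI] si /andP[i0 iI] tab; have iB := ltI_B; have BN := leB_N.
have [NV NNV NNNV] := N_V.
apply: triple_seq; run_block; rewrite sB; split=> //; split=> //.
  by rewrite -PoszM absz_nat; apply: leq_trans NNV; apply: leq_mul; lia.
set s1 := set_reg _ _ _.
have x1 : (0 ^ 2 * i <= n < (0 + B * B * B) ^ 2 * i)%N.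
  rewrite exp0n // mul0n leq0n /=; apply: leq_trans nB _.
  rewrite add0n (_ : B * B * B = B ^ 3)%N; last by lia.
  rewrite -expnM; apply: leq_trans (leq_pmulr _ i0).
  by rewrite leq_pexp2l.
have BB0 : (0 < B * B)%N by rewrite muln_gt0 B_gt0.
have t1 := triple_search (s := s1) (x0 := 0) (h := B * B) sn si erefl erefl i0 BB0 x1.
apply: triple_seq; apply: (triple_weaken (leqnn _) _ (triple_keep (c := search_root) isT t1)).
move=> s2 [[x /= s2x x2] fr2 ce2].
have s2n : regs s2 rn = n%:Z by rewrite fr2.
have s2B : regs s2 rB = B%:Z by rewrite fr2.
have s2I : regs s2 rI = I%:Z by rewrite fr2.
have s2i : regs s2 ri = i%:Z by rewrite fr2.
apply: triple_seq; run_block; rewrite s2B; split=> //.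
  by rewrite absz_nat; lia.
set s3 := set_reg _ _ _.
have t3 := triple_search (s := s3) s2n s2i s2x erefl i0 B_gt0 x2.
apply: triple_seq; apply: (triple_weaken (leqnn _) _ (triple_keep (c := search_root) isT t3)).
move=> s4 [[y /= s4x x4] fr4 ce4].
have s4n : regs s4 rn = n%:Z by rewrite fr4.
have s4B : regs s4 rB = B%:Z by rewrite fr4.
have s4I : regs s4 rI = I%:Z by rewrite fr4.
have s4i : regs s4 ri = i%:Z by rewrite fr4.
apply: triple_seq; run_block; split=> //; first by rewrite ltnW.
set s5 := set_reg _ _ _.
rewrite -[X in (y + X)%N]mul1n in x4.
have t5 := triple_search (s := s5) s4n s4i s4x erefl i0 isT x4.
apply: triple_seq; apply: (triple_weaken (leqnn _) _ (triple_keep (c := search_root) isT t5)).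
move=> s6 [[z /= s6x x6] fr6 ce6].
have s6n : regs s6 rn = n%:Z by rewrite fr6.
have s6B : regs s6 rB = B%:Z by rewrite fr6.
have s6I : regs s6 rI = I%:Z by rewrite fr6.
have s6i : regs s6 ri = i%:Z by rewrite fr6.
have zE := qroot_unique i0 x6.
have zn : (z <= n)%N by rewrite zE qroot_leq.
have cE : cells s6 = cells s by rewrite ce6 /= ce4 /= ce2.
run_block; rewrite s6B s6i s6x -!PoszD !addr_nat.
split=> //; [exact: root_addr|by rewrite absz_nat (leq_trans zn n_V)|].
split=> //; [exact: acc_addr|by rewrite ltnW|].
split=> //; first by rewrite absz_nat addn1 (leq_ltn_trans iI) // (ltn_trans iB) // ltB_V.
split=> //; first by rewrite addn1.
move=> j; rewrite ltnS /entry /= cE !eqz_nat !eqn_add2l => /andP[j0 ji].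
have [->|ij] := eqVneq j i.
  by rewrite acc0 zE ifN // -!addnA !eqn_add2l -[X in _ != X]add0n eqn_add2r; case: (B) B_gt0.
have [h1 h2] : entry 0 j s by apply: tab; rewrite j0 ltn_neqAle ij.
have BB k l : (k < B)%N -> (B + B + B + l == B + B + k)%N = false.
  by move=> kB; apply/eqP; clear -kB; lia.
have BB' k l : (k < B)%N -> (B + B + k == B + B + B + l)%N = false.
  by move=> kB; apply/eqP; clear -kB; lia.
have jB : (j < B)%N by apply: leq_ltn_trans ji (leq_ltn_trans iI iB).
by rewrite BB ?(leq_ltn_trans iI) // BB'.
Qed.

Lemma triple_find_roots s : regs s rn = n%:Z -> regs s rB = B%:Z ->
  triple V mem find_roots s
    (block_time + ((I.+1 - 1) * (root_time + step_time) + step_time))%N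
    (fun s' => env s' /\ forall j, (0 < j <= I)%N -> entry 0 j s').
Proof.
move=> sn sB; have iB := ltI_B; have BN := leB_N; have [NV NNV NNNV] := N_V.
apply: triple_seq; run_block; rewrite sn sB.
have -> : (n%:Z %/ ((B%:Z * B%:Z + 1%N%:Z) * (B%:Z * B%:Z + 1%N%:Z)))%Z = I%:Z.
  by rewrite -[X in (_ %/ X)%Z]/((B * B + 1) * (B * B + 1))%N%:Z divz_nat addn1 !mulnn IE.
split=> //; first by rewrite absz_nat; lia.
split=> //; first by rewrite ltnW.
set s1 := set_reg _ _ _.
pose Inv k s' := [/\ env s', regs s' ri = k%:Z & forall j, (0 < j < k)%N -> entry 0 j s'].
apply: (triple_weaken (leqnn _) _ (triple_for_const V_gt1 (Inv := Inv) _ _ _ _ (a := 1%N) _)) => //.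
- by move=> s' [es' _ tab]; split=> // j; exact: tab.
- move=> k s' kI [[en eB eI] ei tab]; rewrite /= ei eI lez_nat guardE; split; first by lia.
  by apply: triple_root_body.
- by move=> s' [[en eB eI] ei tab]; rewrite /= ei eI lez_nat ltnn.
- by split=> // j; lia.
Qed.

(** Work on the current segment leaves the two tables untouched. *)
Definition upper (s0 s : state) : Prop :=
  forall a : nat, (2 * B <= a)%N -> cells s a%:Z = cells s0 a%:Z.

Definition sieved (lo b k : nat) (s : state) : Prop :=
  cells s k%:Z = (sieve_value b (lo + 1 + k)).1%:Z /\
  cells s (B + k)%N%:Z = (sieve_value b (lo + 1 + k)).2.

Lemma small_addr k : (k < B)%N -> (B + k < mem)%N.
Proof. by rewrite memE => kB; clear -kB; lia. Qed.

Lemma sqB_V : (B * B < V)%N.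
Proof.
have [_ h _] := N_V; have BN := leB_N; apply: leq_trans h.
by apply: ltn_mul.
Qed.

Lemma triple_init s lo : env s -> regs s rl = lo%:Z -> (lo + B <= B * B)%N ->
  triple V mem init_segment s
    (block_time + ((B - 0) * (block_time + step_time) + step_time))%N
    (fun s' => upper s s' /\ forall k, (k < B)%N -> sieved lo 2 k s').
Proof.
move=> [sn sB sI] sl loB; have BV := ltB_V; have BBV := sqB_V.
apply: triple_seq; run_block; split=> //.
pose Inv j s' := [/\ regs s' rB = B%:Z, regs s' rl = lo%:Z, regs s' rk = j%:Z,
  upper s s' & forall k, (k < j)%N -> sieved lo 2 k s'].
apply: (triple_weaken (leqnn _) _ (triple_for_const V_gt1 (Inv := Inv) _ _ _ _ (a := 0%N) _)) => //.
- by move=> s' [].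
- move=> k s' /andP[_ kB] [eB el ek up sv]; rewrite /= ek eB -PoszD lez_nat guardE addn1.
  split=> //; run_block; rewrite ek eB el -!PoszD !addr_nat.
  split=> //; first by rewrite memE; clear -kB; lia.
    by rewrite absz_nat; clear -kB loB BBV; lia.
  split=> //; [exact: small_addr|exact: ltnW|].
  split=> //; first by rewrite absz_nat; clear -kB BV; lia.
  split=> //=; first by rewrite addn1.
    move=> a aB /=; rewrite !eqz_nat !ifN ?up //; apply/eqP; clear -aB kB; lia.
  move=> k'; rewrite ltnS leq_eqVlt => /orP[/eqP->|k'k]; rewrite /sieved /= !eqz_nat.
    rewrite !eqxx (_ : (k == B + k)%N = false) //; apply/eqP; clear -kB; lia.
  have [h1 h2] := sv _ k'k; rewrite !ifN ?h1 ?h2 //; apply/eqP; clear -kB k'k; lia.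
- by move=> s' [eB el ek _ _]; rewrite /= ek eB -PoszD lez_nat addn1 ltnn.
Qed.

Definition sieve_by_time (d : nat) : nat :=
  (block_time + ((block_time + step_time) * (B %/ d + 1) + step_time + block_time))%N.

Lemma triple_sieve_cell s lo d k : env s -> regs s rl = lo%:Z -> regs s rd = d%:Z ->
  regs s rk = k%:Z -> (2 <= d <= B)%N -> (k < B)%N -> (lo + B <= B * B)%N ->
  (d %| lo + 1 + k)%N -> sieved lo d k s ->
  triple V mem sieve_cell s block_time (fun s' =>
    [/\ regs s' rk = (k + d)%N%:Z, sieved lo d.+1 k s' &
      forall a : nat, a != k -> a != (B + k)%N -> cells s' a%:Z = cells s a%:Z]).
Proof.
move=> [sn sB sI] sl sd sk /andP[d2 dB] kB loB dm; rewrite /sieved sieve_valueS //.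
have BV := ltB_V; have BBV := sqB_V.
have m0 : (0 < lo + 1 + k)%N by rewrite addn1.
have [] := sieve_valueP d2 m0.
case: (sieve_value _ _) => r u /= r0 rm u1 _ _ [ck cBk].
have kk : (k == B + k)%N = false by apply/eqP; clear -kB; lia.
have kdV : (`|(k%:Z + d%:Z)%R| <= V)%N by clear -kB dB BBV d2; nia.
have rV : (r <= V)%N.
  by apply: leq_trans (dvdn_leq m0 rm) _; clear -loB BBV kB; lia.
run_block; rewrite sk ck addr_nat; split=> //; first by clear -kB memE; lia.
rewrite sd !modz_nat testE /sieve_step /= divz_nat.
rewrite modz_nat testE sB -!PoszD !eqz_nat addr_nat eqxx kk.
rewrite [(B + k == k)%N]eq_sym kk cBk sub0r.
rewrite -![(_ %% d == 0)%N]/(_ %| _)%N small_addr //; split=> //.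
have rdV : (r %/ d <= V)%N by apply: leq_trans (leq_div _ _) rV.
case: (boolP (d %| r)%N) => dr /=; last by split=> //; split.
split=> //; split=> //; first by clear -kB memE; lia.
split=> //; case: (boolP (d %| r %/ d)%N) => dr2 /=; split=> //.
- split=> //; split=> //; rewrite ?eqxx // => a ak aBk.
  by rewrite !eqz_nat (negPf ak) (negPf aBk).
- by rewrite abszN (leq_trans u1) // ltnW.
- split=> //; split=> //; rewrite ?eqxx // => a ak aBk.
  by rewrite !eqz_nat (negPf ak) (negPf aBk).
Qed.
Lemma sieved_skip s lo d k : (2 <= d)%N -> ~~ (d %| lo + 1 + k)%N ->
  sieved lo d k s -> sieved lo d.+1 k s.
Proof.
move=> d2 dk; rewrite /sieved sieve_valueS // /sieve_step ifN //.
have m0 : (0 < lo + 1 + k)%N by rewrite addn1.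
by have [_ rm _ _ _] := sieve_valueP d2 m0; apply: contra dk => /dvdn_trans; apply.
Qed.

(** Only multiples of d need to be visited: the unfactored part divides m, so
    the state of the other m is unchanged by d (sieved_skip).  Cells before the
    current multiple are in the state after d, the others in the state before. *)
Lemma triple_sieve_by s lo d : env s -> regs s rl = lo%:Z -> regs s rd = d%:Z ->
  (2 <= d <= B)%N -> (lo + B <= B * B)%N ->
  (forall k, (k < B)%N -> sieved lo d k s) ->
  triple V mem sieve_by s (sieve_by_time d) (fun s' =>
    [/\ regs s' rd = d.+1%:Z, upper s s' &
      forall k, (k < B)%N -> sieved lo d.+1 k s']).
Proof.
move=> [sn sB sI] sl sd dB loB sv; have BV := ltB_V.
have /andP[d2 leB] := dB; have d0 : (0 < d)%N by rewrite ltnW.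
have [k0 k0E /andP[k0d dk0]] := neg_modz (lo + 1) d0.
have gap k k' : (d %| lo + 1 + k)%N -> (k < k' < k + d)%N -> ~~ (d %| lo + 1 + k')%N.
  move=> dk /andP[kk' k'd]; rewrite (_ : lo + 1 + k' = lo + 1 + k + (k' - k))%N.
    by rewrite dvdn_addr // gtnNdvd //; clear -kk' k'd; lia.
  by clear -kk'; lia.
apply: triple_seq; run_block; rewrite sl sd -PoszD k0E; split=> //.
  by rewrite absz_nat ltnW // (ltn_trans k0d) // (leq_ltn_trans leB).
set s1 := set_reg _ _ _.
(* The number of multiples left is the ceiling of (B - k) / d. *)
pose Inv p s' := exists k : nat, [/\ p = ((block_time + step_time) * ((B + d - 1 - k) %/ d))%N,
  [/\ env s', regs s' rl = lo%:Z, regs s' rd = d%:Z & regs s' rk = k%:Z],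
  upper s s', (d %| lo + 1 + k)%N &
  forall j, (j < B)%N -> (if (j < k)%N then sieved lo d.+1 j s' else sieved lo d j s')].
have I1 : Inv ((block_time + step_time) * ((B + d - 1 - k0) %/ d))%N s1.
  exists k0; split=> // j jB; case: ifP => jk; last exact: sv.
  apply: sieved_skip => //; last exact: sv.
  apply/negP => dj; have := gap j k0 dj; rewrite jk dk0 (leq_trans k0d) ?leq_addl //.
  by move/(_ isT).
apply: triple_seq.
apply: triple_weaken _ _ (triple_frame (triple_while V_gt1 (Inv := Inv) _ _ I1)) => //; last first.
- move=> p s' [k [-> [[en eB eI] el ed ek] up dk svk]].
  rewrite /= ek eB -PoszD lez_nat guardE addn1 => kB.
  exists block_time; have svk' : sieved lo d k s' by have := svk k kB; rewrite ltnn.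
  apply: triple_weaken (leqnn _) _ (triple_frame (triple_sieve_cell _ el ed ek dB kB loB dk svk')) => //.
  move=> s2 [[e2k sv2 ce2] fr2].
  exists ((block_time + step_time) * ((B + d - 1 - (k + d)) %/ d))%N; split; last first.
    rewrite -addnA -mulnSr leq_mul2l -addn1; apply/orP; right.
    have -> : (B + d - 1 - k = B + d - 1 - (k + d) + d)%N by clear -kB d0; lia.
    by rewrite divnDr // divnn d0.
  exists (k + d)%N; split=> //.
  + by split; [split; rewrite fr2 | rewrite fr2 | rewrite fr2 | ].
  + move=> a aB; rewrite ce2 ?up //; apply/eqP; clear -aB kB; lia.
  + by rewrite addnA dvdn_addl.
  move=> j jB.
  have [->|jk] := eqVneq j k; first by rewrite -[X in (X < _)%N]addn0 ltn_add2l d0.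
  have same b : sieved lo b j s' -> sieved lo b j s2.
    case=> h1 h2; split; rewrite ce2 //; rewrite ?eqn_add2l //; apply/eqP; clear -jB kB; lia.
  have := svk j jB; case: (ltnP j k) => [jk' svj|kj svj].
    by rewrite ifT; [exact: same|clear -jk'; lia].
  case: ifP => jkd; last exact: same.
  apply/same/sieved_skip => //; apply: gap dk _.
  by rewrite jkd andbT ltn_neqAle eq_sym jk.
- move=> s2 [[p [k [_ [[en eB eI] el ed ek] up dk svk]] e0] fr2].
  run_block; rewrite ed -?PoszD; split=> //; first by rewrite absz_nat addn1 (leq_ltn_trans leB).
  split=> //=; first by rewrite addn1.
  move: e0; rewrite /= ek eB -PoszD lez_nat addn1 => /guardN; rewrite -leqNgt => Bk.
  by move=> j jB; have := svk j jB; rewrite (leq_trans jB).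
rewrite leq_add2r leq_mul2l; apply/orP; right.
have -> : (B %/ d + 1 = (B + d) %/ d)%N by rewrite divnDr // divnn d0.
by apply: leq_div2r; clear; lia.
Qed.

Definition sieve_time : nat :=
  (block_time + (\sum_(2 <= d < B.+1) (sieve_by_time d + step_time) + step_time))%N.

Lemma triple_sieve s lo : env s -> regs s rl = lo%:Z ->
  (lo + B <= B * B)%N -> (forall k, (k < B)%N -> sieved lo 2 k s) ->
  triple V mem sieve s sieve_time (fun s' =>
    upper s s' /\ forall k, (k < B)%N -> sieved lo B.+1 k s').
Proof.
move=> [sn sB sI] sl loB sv.
apply: triple_seq; run_block; split=> //.
set s1 := set_reg _ _ _.
pose Inv d s' := [/\ env s', regs s' rl = lo%:Z, regs s' rd = d%:Z, upper s s' &
  forall k, (k < B)%N -> sieved lo d k s'].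
apply: (triple_weaken (leqnn _) _ (triple_for V_gt1 (Inv := Inv) _ _ _ _ (a := 2) _)) => //.
- by move=> s' [].
- move=> d s' dB [[en eB eI] el ed up svd]; rewrite /= ed eB lez_nat guardE.
  split; first by case/andP: dB.
  apply: (triple_weaken (leqnn _) _ (triple_frame (triple_sieve_by _ el ed dB loB svd))) => //.
  move=> s2 [[e2d up2 sv2] fr2]; split=> //; [by split; rewrite fr2|by rewrite fr2|].
  by move=> a aB; rewrite up2 // up.
- by move=> s' [[en eB eI] _ ed _ _]; rewrite /= ed eB lez_nat ltnn.
Qed.

Definition small_part (x : nat) : int := \sum_(1 <= d < x.+1) mu d * (n %/ d ^ 2)%:Z.

Lemma small_part_abs x : (x <= B * B)%N -> (`|small_part x| <= N * N * N)%N.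
Proof.
move=> xB; apply: leq_trans (@absz_sum_leq _ _ _ n _) _.
  move=> d _; rewrite abszM absz_nat; apply: leq_trans (leq_mul (mu_abs d) (leq_div n _)) _.
  by rewrite mul1n.
have BN := ltnW leB_N; rewrite subn1 /=; apply: leq_mul; last by rewrite NE; clear; lia.
by apply: leq_trans xB _; apply: leq_mul.
Qed.

Lemma triple_prefix s lo : env s -> regs s rl = lo%:Z -> (lo + B <= B * B)%N ->
  regs s rM = mertens lo -> regs s rS = small_part lo ->
  (forall k, (k < B)%N -> sieved lo B.+1 k s) ->
  triple V mem prefix_sums s
    (block_time + ((B - 0) * (block_time + step_time) + step_time))%N
    (fun s' => [/\ regs s' rM = mertens (lo + B), regs s' rS = small_part (lo + B),
       upper s s' &
       forall k, (k < B)%N -> cells s' (B + k)%N%:Z = mertens (lo + 1 + k)]).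
Proof.
move=> [sn sB sI] sl loB sM sS sv; have BV := ltB_V; have BBV := sqB_V.
have NNNV : (N * N * N <= V)%N.
  by have [_ _ h] := N_V; apply: leq_trans h; rewrite leq_pmull.
apply: triple_seq; run_block; split=> //.
pose Inv j s' := [/\ [/\ env s', regs s' rl = lo%:Z & regs s' rk = j%:Z],
  regs s' rM = mertens (lo + j), regs s' rS = small_part (lo + j),
  upper s s' &
  (forall k, (k < j)%N -> cells s' (B + k)%N%:Z = mertens (lo + 1 + k)) /\
  (forall k, (j <= k < B)%N -> sieved lo B.+1 k s')].
apply: (triple_weaken (leqnn _) _ (triple_for_const V_gt1 (Inv := Inv) _ _ _ _ (a := 0%N) _)) => //.
- by move=> s' [? ? ? ? []].
- move=> k s' /andP[_ kB] [[[en eB eI] el ek] eM eS up [done todo]].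
  rewrite /= ek eB -PoszD lez_nat guardE addn1; split=> //.
  have m2 : (0 < lo + 1 + k <= B ^ 2)%N.
    by rewrite -mulnn; clear -kB loB; lia.
  have := sieve_value_mu B_gt0 m2.
  have [|] := todo k; first by rewrite leqnn.
  case: (sieve_value _ _) => r u /= ck cBk muE.
  have mertS : mertens (lo + k.+1) = mertens (lo + k) + mu (lo + 1 + k).
    by rewrite /mertens addnS big_nat_recr //= -addnA add1n addnS.
  have partS : small_part (lo + k.+1) =
      small_part (lo + k) + mu (lo + 1 + k) * (n %/ (lo + 1 + k) ^ 2)%:Z.
    by rewrite /small_part addnS big_nat_recr //= -addnA add1n addnS.
  have kV : (k + 1 <= V)%N by clear -kB BV; lia.
  have mV : (lo + 1 + k <= V)%N by clear -kB loB BBV; lia.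
  have MV : (`|(mertens (lo + k) + mu (lo + 1 + k))%R| <= V)%N.
    rewrite -mertS; apply: leq_trans (mertens_abs _) _; clear -kB loB BBV; lia.
  have SV : (`|(small_part (lo + k) + mu (lo + 1 + k) * (n %/ (lo + 1 + k) ^ 2)%:Z)%R| <= V)%N.
    rewrite -partS; apply: leq_trans (small_part_abs _) NNNV; clear -kB loB; lia.
  have uV : (`|mu (lo + 1 + k)| <= V)%N by apply: leq_trans (mu_abs _) (ltnW V_gt1).
  run_block; rewrite ek el eB en eM eS -!PoszD !addr_nat ck cBk.
  rewrite sub0r -!PoszM divz_nat lez_nat testE mulnn small_addr //.
  have km : (k < mem)%N by clear -kB memE; lia.
  have uV' : (`|u| <= V)%N by move: uV; rewrite muE; case: ifP; rewrite ?abszN.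
  have inv t : env t -> regs t rl = lo%:Z -> regs t rk = (k + 1)%N%:Z ->
      regs t rM = mertens (lo + k.+1) -> regs t rS = small_part (lo + k.+1) ->
      (forall a : nat, a != (B + k)%N -> cells t a%:Z = cells s' a%:Z) ->
      cells t (B + k)%N%:Z = mertens (lo + k.+1) -> Inv k.+1 t.
    move=> et tl tk tM tS tc tBk; split=> //; first by split=> //; rewrite tk addn1.
      by move=> a aB; rewrite tc ?up //; apply/eqP; clear -aB kB; lia.
    split=> j.
      rewrite ltnS leq_eqVlt => /orP[/eqP->|jk]; first by rewrite tBk -addnA add1n.
      by rewrite tc ?done // eqn_add2l ltn_eqF.
    case/andP=> kj jB; have [|h1 h2] := todo j; first by rewrite jB ltnW.
    by split; rewrite tc //; apply/eqP; clear -kj jB; lia.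
  rewrite -mertS in MV; rewrite -partS in SV.
  case: (2 <= r)%N muE => muE; rewrite -muE -mertS -partS.
    do 8! [split=> //].
    apply: inv => //= [a aBk|]; first by rewrite eqz_nat (negPf aBk).
    by rewrite eqxx.
  do 7! [split=> //].
  apply: inv => //= [a aBk|]; first by rewrite eqz_nat (negPf aBk).
  by rewrite eqxx.
- by move=> s' [[[en eB eI] el ek] _ _ _ _]; rewrite /= ek eB -PoszD lez_nat addn1 ltnn.
- split=> //; rewrite ?addn0 //; split=> // k /andP[_ kB]; exact: sv.
Qed.
(** Crude: at most n + 1 terms, each at most n. *)
Lemma sum_mertens_abs i a b : (0 < i)%N -> (b <= (qroot n i).+1)%N ->
  (absz (\sum_(a <= d < b) mertens (qroot n i %/ d))%R <= N * N)%N.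
Proof.
move=> i0 bx; have xn := qroot_leq n i0.
apply: leq_trans (@absz_sum_leq _ _ _ n _) _.
  by move=> d _; apply: leq_trans (mertens_abs _) (leq_trans (leq_div _ _) xn).
by apply: leq_mul; rewrite NE; clear -bx xn; lia.
Qed.

Lemma acc_step i lo : acc i (lo + B) = acc i lo -
  \sum_((qroot n i %/ (lo + B).+1).+1 <= d < (qroot n i %/ lo.+1).+1)
     mertens (qroot n i %/ d).
Proof.
rewrite /acc; set x := qroot n i.
rewrite (@big_cat_nat _ _ _ (x %/ lo.+1).+1 (x %/ (lo + B).+1).+1 x.+1) //=.
- by rewrite opprD addrA addrAC.
- by rewrite ltnS leq_div2l // ltnS leq_addr.
- by rewrite ltnS leq_div.
Qed.

(** An upper bound for the number of blocks of equal quotients that i meets in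
    the segment after lo: at most one per value, and at most one per divisor. *)
Definition hits (lo i : nat) : nat :=
  minn B (qroot n i %/ lo.+1 - qroot n i %/ (lo + B).+1).

Lemma acc_abs i lo a b : (0 < i)%N -> (b <= (qroot n i).+1)%N ->
  (absz (acc i lo - \sum_(a <= d < b) mertens (qroot n i %/ d))%R <= V)%N.
Proof.
move=> i0 bx; have h1 := sum_mertens_abs a i0 bx.
have := @sum_mertens_abs i (qroot n i %/ lo.+1).+1 (qroot n i).+1 i0 (leqnn _).
rewrite /acc; move: h1; set y := \sum_(_ <= d < b) _; set z := \sum_(_ <= d < _) _.
have NN : (1 + N * N + N * N <= V)%N.
  by apply: leq_trans V_big; rewrite NE; clear; nia.
by clear -NN; lia.
Qed.

(** The potential is the minimum of the number of values and of the number of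
    divisors that remain in the segment. *)
Lemma triple_group s i lo (x := qroot n i) : env s -> regs s rl = lo%:Z ->
  (0 < i <= I)%N -> (lo + B <= B * B)%N ->
  (forall k, (k < B)%N -> cells s (B + k)%N%:Z = mertens (lo + 1 + k)) ->
  regs s rx = x%:Z -> regs s rd = (x %/ (lo + B).+1).+1%:Z ->
  regs s re = (x %/ lo.+1)%:Z -> regs s ra = acc i lo ->
  triple V mem (While (!rd [<=] !re) group_body) s
    ((block_time + step_time) * hits lo i + step_time)%N
    (fun s' => regs s' ra = acc i (lo + B)).
Proof.
move=> [sn sB sI] sl /andP[i0 iI] loB tab sx sd se sa.
have BV := ltB_V; have BBV := sqB_V.
have xV : (x < V)%N.
  have xn := qroot_leq n i0; have [h _ _] := N_V; apply: leq_trans h.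
  by rewrite NE ltnS (leq_trans xn).
pose e := (x %/ lo.+1)%N; pose d0 := (x %/ (lo + B).+1)%N.
have d0e : (d0 <= e)%N by rewrite leq_div2l // ltnS leq_addr.
have ex : (e <= x)%N by rewrite leq_div.
pose Inv p s' := exists d : nat,
  [/\ [/\ regs s' rB = B%:Z, regs s' rl = lo%:Z, regs s' rx = x%:Z,
      regs s' re = e%:Z & regs s' rd = d%:Z], cells s' = cells s,
  regs s' ra = acc i lo - \sum_(d0.+1 <= d' < d) mertens (x %/ d'),
  (d0 < d <= e.+1)%N &
  p = ((block_time + step_time) * minn (x %/ d - lo) (e.+1 - d))%N].
have Inv0 : Inv ((block_time + step_time) * minn (x %/ d0.+1 - lo) (e.+1 - d0.+1))%N s.
  exists d0.+1; split=> //; first by rewrite big_geq ?subr0.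
  by rewrite leqnn.
apply: triple_weaken _ _ (triple_while V_gt1 (Inv := Inv) _ _ Inv0) => //; last first.
- move=> p s' [d [[eB el exx ee ed] ec ea /andP[d0d de] ->]].
  rewrite /= ed ee lez_nat guardE => dle.
  have dx : (0 < d <= x)%N by rewrite (leq_ltn_trans _ d0d) // (leq_trans dle).
  have [] := divn_constant dx; have := sum_divn_constant mertens dx.
  set v := (x %/ d)%N; set t := (x %/ v)%N => sumE v0 dt _ vlt.
  have dpos : (0 < d)%N by case/andP: dx.
  have vlo : (lo < v)%N by rewrite leq_divRL // mulnC -leq_divRL.
  have vhi : (v < (lo + B).+1)%N by rewrite ltn_divLR // mulnC -ltn_divLR.
  have te : (t <= e)%N by apply: leq_div2l.
  have [k kB vE] : exists2 k, (k < B)%N & v = (lo + 1 + k)%N.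
    by exists (v - lo - 1)%N; clear -vlo vhi; lia.
  have aE : acc i lo - \sum_(d0.+1 <= d' < d) mertens (x %/ d')
      - mertens v * (t.+1 - d)%N%:Z =
      acc i lo - \sum_(d0.+1 <= d' < t.+1) mertens (x %/ d').
    rewrite -sumE (@big_cat_nat _ _ _ d d0.+1 t.+1) //=; last exact: leqW.
    by rewrite opprD addrA.
  exists block_time; run_block; rewrite exx ed divz_nat -/v divz_nat -/t.
  rewrite eB el ec ea.
  have -> : (B%:Z + (v%:Z - lo%:Z - 1%N%:Z) = (B + k)%N%:Z :> int) by clear -vE; lia.
  have -> : (t%:Z + 1%N%:Z - d%:Z = (t.+1 - d)%N%:Z :> int) by clear -dt; lia.
  rewrite tab // -vE aE addr_nat small_addr //.
  have tV : (t + 1 <= V)%N by clear -te ex xV; lia.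
  split=> //; first by rewrite absz_nat ltnW // (leq_ltn_trans (leq_div _ _)).
  split=> //; first by rewrite absz_nat; clear -tV; lia.
  split=> //; first by apply: acc_abs => //; rewrite ltnS (leq_trans te).
  split=> //; rewrite -PoszD addn1.
  exists ((block_time + step_time) * minn (x %/ t.+1 - lo) (e.+1 - t.+1))%N; split.
    by exists t.+1; split=> //; rewrite !ltnS te andbT ltnW // (leq_trans d0d).
  rewrite -addnA -mulnSr leq_mul2l; apply/orP; right.
  exact: minn_decreases.
- move=> s' [p [d [[eB el exx ee ed] ec ea /andP[d0d de] _]]].
  rewrite /= ed ee lez_nat => /guardN; rewrite -ltnNge => ed'.
  rewrite ea acc_step; congr (_ - _); rewrite (_ : d = e.+1) //.
  by clear -ed' de; lia.
rewrite leq_add2r leq_mul2l; apply/orP; right; rewrite /hits leq_min.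
have h : (x %/ d0.+1 < (lo + B).+1)%N.
  by rewrite ltn_divLR // mulnC ltn_ceil.
rewrite -/x -/e -/d0; clear -h; lia.
Qed.

Definition gather_time (lo i : nat) : nat :=
  (block_time + ((block_time + step_time) * hits lo i + step_time + block_time))%N.

Lemma triple_gather_body s i lo : env s -> regs s rl = lo%:Z -> regs s ri = i%:Z ->
  (0 < i <= I)%N -> (lo + B <= B * B)%N ->
  (forall k, (k < B)%N -> cells s (B + k)%N%:Z = mertens (lo + 1 + k)) ->
  entry lo i s ->
  triple V mem gather_body s (gather_time lo i) (fun s' =>
    [/\ regs s' ri = i.+1%:Z, entry (lo + B) i s' &
      forall a : nat, a != (B + B + i)%N -> cells s' a%:Z = cells s a%:Z]).
Proof.
move=> es sl si iI loB tab [cx ca]; have [sn sB sI] := es; have BV := ltB_V.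
have /andP[i0 iI'] := iI; set x := qroot n i in cx *.
have xn : (x <= n)%N by rewrite qroot_leq.
have xV : (x < V)%N by have [h _ _] := N_V; apply: leq_trans h; rewrite NE ltnS (leq_trans xn).
apply: triple_seq; run_block; rewrite sB si -!PoszD !addr_nat cx ca sl -!PoszD !divz_nat !addn1.
split=> //; [exact: root_addr|exact: ltnW|].
split=> //; first by rewrite absz_nat addn1 (leq_ltn_trans (leq_div _ _)).
split=> //; first by rewrite absz_nat ltnW // (leq_ltn_trans (leq_div _ _)).
have aV lo' : (`|acc i lo'| <= V)%N.
  by have := @acc_abs i lo' 0 0 i0 isT; rewrite big_geq // subr0.
split=> //; first exact: acc_addr.
rewrite -PoszD addn1; set s1 := set_reg _ _ _.
have t1 := triple_group (s := s1) (And3 sn sB sI) sl iI loB tab erefl erefl erefl erefl.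
apply: triple_seq; apply: (triple_weaken (leqnn _) _ (triple_keep _ t1)) => //.
move=> s2 [e2a fr2 c2].
have s2B : regs s2 rB = B%:Z by rewrite fr2.
have s2i : regs s2 ri = i%:Z by rewrite fr2.
run_block; rewrite s2B s2i e2a -!PoszD !addr_nat c2.
split=> //; first exact: acc_addr.
split=> //; first by rewrite absz_nat addn1 (leq_trans _ BV) // ltnS ltnW // (leq_ltn_trans iI') // ltI_B.
split=> //=; first by rewrite addn1.
  split=> /=; last by rewrite eqxx.
  rewrite eqz_nat (_ : (B + B + B + i == B + B + i)%N = false) ?c2 //.
  by apply/eqP; clear -B_gt0; lia.
by move=> a ai; rewrite /= eqz_nat (negPf ai).
Qed.

Definition gather_total (lo : nat) : nat :=
  (block_time + (\sum_(1 <= i < I.+1) (gather_time lo i + step_time) + step_time))%N.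

Lemma triple_gather s lo : env s -> regs s rl = lo%:Z -> (lo + B <= B * B)%N ->
  (forall k, (k < B)%N -> cells s (B + k)%N%:Z = mertens (lo + 1 + k)) ->
  (forall i, (0 < i <= I)%N -> entry lo i s) ->
  triple V mem gather s (gather_total lo) (fun s' =>
    forall i, (0 < i <= I)%N -> entry (lo + B) i s').
Proof.
move=> [sn sB sI] sl loB tab ent; have iB := ltI_B.
apply: triple_seq; run_block; split=> //; first exact: ltnW.
pose Inv j s' := [/\ [/\ env s', regs s' rl = lo%:Z & regs s' ri = j%:Z],
  forall k, (k < B)%N -> cells s' (B + k)%N%:Z = mertens (lo + 1 + k),
  forall i, (0 < i < j)%N -> entry (lo + B) i s' &
  forall i, (0 < i <= I)%N -> (j <= i)%N -> entry lo i s'].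
apply: (triple_weaken (leqnn _) _ (triple_for V_gt1 (Inv := Inv) _ _ _ _ (a := 1) _)) => //.
- by move=> s' [_ _ done _] i iI; apply: done; rewrite ltnS.
- move=> i s' iI [[[en eB eI] el ei] etab done todo]; rewrite /= ei eI lez_nat guardE.
  have iI' : (0 < i <= I)%N by rewrite -ltnS.
  have /andP[i0 leiI] := iI'; split=> //.
  apply: (triple_weaken (leqnn _) _ (triple_frame
    (triple_gather_body _ el ei iI' loB etab (todo i iI' (leqnn _))))) => //.
  move=> s2 [[e2i ent2 c2] fr2].
  have keep lo' j : j != i -> entry lo' j s' -> (j <= I)%N -> entry lo' j s2.
    move=> ji [h1 h2] jI; split; rewrite c2 ?eqn_add2l //.
    by apply/eqP; clear -leiI iB; lia.
  split=> //.
  + by split; [split; rewrite fr2|rewrite fr2|].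
  + by move=> k kB; rewrite c2 ?etab //; apply/eqP; clear -kB i0; lia.
  + move=> j /andP[j0]; rewrite ltnS leq_eqVlt => /orP[/eqP->//|ji].
    apply: keep; [by rewrite ltn_eqF | by apply: done; rewrite j0 |].
    exact: leq_trans (ltnW ji) leiI.
  move=> j jI ij; apply: keep; first by rewrite gtn_eqF.
    by apply: todo => //; exact: ltnW.
  by case/andP: jI.
- by move=> s' [[[en eB eI] el ei] _ _ _]; rewrite /= ei eI lez_nat ltnn.
- by split=> // [[|[]]|i iI _] //; apply: ent.
Qed.

Definition segment_time (lo : nat) : nat :=
  (block_time + ((B - 0) * (block_time + step_time) + step_time) +
   (sieve_time + (block_time + ((B - 0) * (block_time + step_time) + step_time) +
   (gather_total lo + block_time))))%N.

Lemma triple_segment s lo : env s -> regs s rl = lo%:Z -> (lo + B <= B * B)%N ->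
  regs s rM = mertens lo -> regs s rS = small_part lo ->
  (forall i, (0 < i <= I)%N -> entry lo i s) ->
  triple V mem segment s (segment_time lo) (fun s' =>
    [/\ regs s' rl = (lo + B)%N%:Z, regs s' rM = mertens (lo + B),
        regs s' rS = small_part (lo + B) &
        forall i, (0 < i <= I)%N -> entry (lo + B) i s']).
Proof.
move=> [sn sB sI] sl loB sM sS ent; have BBV := sqB_V.
have up_entry t t' : upper t t' -> (forall i, (0 < i <= I)%N -> entry lo i t) ->
    forall i, (0 < i <= I)%N -> entry lo i t'.
  by move=> up h i iI; have [h1 h2] := h i iI; split; rewrite up //; clear; lia.
apply: triple_seq.
apply: (triple_weaken (leqnn _) _ (triple_frame (triple_init (And3 sn sB sI) sl loB))) => //.
move=> s1 [[up1 sv1] fr1]; have ent1 := up_entry _ _ up1 ent.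
have es1 : env s1 by split; rewrite fr1.
have sl1 : regs s1 rl = lo%:Z by rewrite fr1.
apply: triple_seq.
apply: (triple_weaken (leqnn _) _ (triple_frame (triple_sieve es1 sl1 loB sv1))) => //.
move=> s2 [[up2 sv2] fr2]; have ent2 := up_entry _ _ up2 ent1.
have es2 : env s2 by split; rewrite fr2 // fr1.
have sl2 : regs s2 rl = lo%:Z by rewrite fr2.
have sM2 : regs s2 rM = mertens lo by rewrite fr2 // fr1.
have sS2 : regs s2 rS = small_part lo by rewrite fr2 // fr1.
apply: triple_seq.
apply: (triple_weaken (leqnn _) _ (triple_frame (triple_prefix es2 sl2 loB sM2 sS2 sv2))) => //.
move=> s3 [[sM3 sS3 up3 tab3] fr3]; have ent3 := up_entry _ _ up3 ent2.
have es3 : env s3 by case: es2 => *; split; rewrite fr3.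
have sl3 : regs s3 rl = lo%:Z by rewrite fr3.
apply: triple_seq.
apply: (triple_weaken (leqnn _) _ (triple_frame (triple_gather es3 sl3 loB tab3 ent3))) => //.
move=> s4 [ent4 fr4]; have [_ sB3 _] := es3.
have sB4 : regs s4 rB = B%:Z by rewrite fr4.
have sl4 : regs s4 rl = lo%:Z by rewrite fr4.
have sM4 : regs s4 rM = mertens (lo + B) by rewrite fr4.
have sS4 : regs s4 rS = small_part (lo + B) by rewrite fr4.
run_block; rewrite sl4 sB4 -PoszD; split=> //.
by rewrite absz_nat (leq_trans loB) // ltnW.
Qed.

Definition all_segments_time : nat :=
  (block_time + (\sum_(0 <= j < B) (segment_time (j * B) + step_time) + step_time))%N.

Lemma triple_all_segments s : env s -> (forall i, (0 < i <= I)%N -> entry 0 i s) ->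
  triple V mem all_segments s all_segments_time (fun s' =>
    [/\ env s', regs s' rM = mertens (B * B), regs s' rS = small_part (B * B) &
        forall i, (0 < i <= I)%N -> entry (B * B) i s']).
Proof.
move=> [sn sB sI] ent.
apply: triple_seq; run_block; split=> //; split=> //; split=> //.
pose Inv j s' := [/\ env s', regs s' rl = (j * B)%N%:Z,
  regs s' rM = mertens (j * B), regs s' rS = small_part (j * B) &
  forall i, (0 < i <= I)%N -> entry (j * B) i s'].
apply: (triple_weaken (leqnn _) _ (triple_for V_gt1 (Inv := Inv)
  (f := fun j => segment_time (j * B)) _ _ _ _ (a := 0%N) _)) => //.
- by move=> s' [].
- move=> j s' /andP[_ jB] [es' el eM eS ent']; have [en eB eI] := es'.
  rewrite /= el eB -PoszD -PoszM lez_nat addn1 guardE ltn_mul2r jB B_gt0; split=> //.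
  have loB : (j * B + B <= B * B)%N by rewrite addnC -mulSn leq_mul2r jB orbT.
  apply: (triple_weaken (leqnn _) _ (triple_frame (triple_segment es' el loB eM eS ent'))) => //.
  move=> s2 [[e2l e2M e2S ent2] fr2].
  have jE : (j * B + B = j.+1 * B)%N by rewrite addnC -mulSn.
  rewrite jE in e2l e2M e2S ent2; split=> //.
  by split; rewrite fr2.
- by move=> s' [[en eB eI] el _ _ _]; rewrite /= el eB -PoszD -PoszM lez_nat addn1 ltnn.
- split=> //; first by rewrite mul0n /mertens big_geq.
  by rewrite mul0n /small_part big_geq.
Qed.

Definition combine_body_time : nat :=
  (block_time + ((B * (block_time + step_time) + step_time) + block_time))%N.

Lemma ltD_qroot i : (0 < i <= I)%N -> (B * B < qroot n i)%N.
Proof.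
move=> /andP[i0 iI]; rewrite leq_qroot // mulnC -leq_divRL ?expn_gt0 //.
by rewrite mulnn -IE.
Qed.

(** The condition tested by the program, and the range of d in
    mertens_recursion, agree. *)
Lemma leq_index i d : (0 < i)%N -> (0 < d)%N ->
  (i * d ^ 2 <= I)%N = (d <= qroot n i %/ (B * B).+1)%N.
Proof.
move=> i0 d0; rewrite IE !leq_divRL ?expn_gt0 // leq_qroot // mulnn.
by congr leq; rewrite expnMn; lia.
Qed.

Definition large_part (i : nat) : int :=
  \sum_(i.+1 <= j < I.+1) (mertens (qroot n j) - mertens (B * B)).

Lemma total_abs i : (`|(small_part (B * B) + large_part i)%R| <= V)%N.
Proof.
have h1 := small_part_abs (leqnn (B * B)); have BN := leB_N.
have h2 : (`|large_part i| <= N * (N + N * N))%N.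
  apply: leq_trans (@absz_sum_leq _ _ _ (N + N * N) _) _.
    move=> j /andP[ij jI]; have j0 : (0 < j)%N by apply: leq_trans ij.
    have hj := leq_trans (mertens_abs (qroot n j)) (qroot_leq n j0).
    have hB := mertens_abs (B * B).
    have : (B * B <= N * N)%N by apply: leq_mul; apply: ltnW.
    by move: hj hB NE; clear; lia.
  rewrite leq_mul2r; apply/orP; right.
  by have := ltI_B; move: BN; clear; lia.
have h3 : (N * N * N + N * (N + N * N) <= V)%N.
  by apply: leq_trans V_big; rewrite NE; clear; nia.
by move: h1 h2 h3; clear; lia.
Qed.

(** The entries j > i already hold M(x_j); those read here have index i d^2
    with d >= 2, which is larger than i. *)
Lemma triple_combine_body s i : env s -> regs s ri = i%:Z -> (0 < i <= I)%N ->
  regs s rM = mertens (B * B) -> regs s rS = small_part (B * B) + large_part i ->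
  entry (B * B) i s ->
  (forall j, (i < j <= I)%N -> cells s (B + B + j)%N%:Z = mertens (qroot n j)) ->
  triple V mem combine_body s combine_body_time (fun s' =>
    [/\ regs s' ri = i.-1%:Z, regs s' rS = small_part (B * B) + large_part i.-1,
       cells s' (B + B + i)%N%:Z = mertens (qroot n i) &
      forall a : nat, a != (B + B + i)%N -> cells s' a%:Z = cells s a%:Z]).
Proof.
move=> [sn sB sI] si iI sM sS [cx ca] tab; have /andP[i0 leiI] := iI.
set x := qroot n i in cx *; have BV := ltB_V; have BBV := sqB_V.
have Dx : (B * B < x)%N by apply: ltD_qroot.
pose b := (x %/ (B * B).+1).+1.
have b2 : (2 <= b)%N by rewrite ltnS divn_gt0.
have bx : (b <= x.+1)%N by rewrite ltnS leq_div.
have inI d : (0 < d < b)%N -> (i * d ^ 2 <= I)%N.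
  by case/andP=> d0 db; rewrite leq_index.
have dB d : (0 < d < b)%N -> (d < B)%N.
  move=> h; have := leq_ltn_trans (inI d h) ltI_B; apply: leq_ltn_trans.
  by rewrite -mulnn mulnA; case/andP: h => d0 _; rewrite -[X in (X <= _)%N]mul1n leq_mul2r muln_gt0 i0 d0 orbT.
have aV d : (d <= b)%N ->
    (absz (acc i (B * B) - \sum_(2 <= d' < d) mertens (x %/ d'))%R <= V)%N.
  by move=> db; apply: acc_abs; rewrite // (leq_trans db).
apply: triple_seq; run_block; rewrite sB si -!PoszD !addr_nat ca.
split=> //; [exact: acc_addr| |].
  by have := aV 2 b2; rewrite big_geq // subr0.
split=> //; set s1 := set_reg _ _ _.
pose Inv d s' := [/\ [/\ regs s' rB = B%:Z, regs s' rI = I%:Z, regs s' ri = i%:Z & regs s' rd = d%:Z],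
  cells s' = cells s & regs s' ra = acc i (B * B) - \sum_(2 <= d' < d) mertens (x %/ d')].
have step d s' : (2 <= d < b)%N -> Inv d s' ->
    eval_expr s' (!ri [*] !rd [*] !rd [<=] !rI) != 0 /\
    triple V mem (ra ::= !ra [-] Read (acc_at (!ri [*] !rd [*] !rd)) ;;
     rd ::= !rd [+] one) s' block_time (Inv d.+1).
  move=> /andP[d2 db] [[eB eI ei ed] ec ea].
  have d0 : (0 < d)%N by apply: ltnW.
  have idI := inI d; rewrite d0 db in idI.
  have dE : (i * d * d = i * d ^ 2)%N by rewrite -mulnA mulnn.
  rewrite /= ei ed eI -!PoszM lez_nat guardE dE idI //; split=> //.
  run_block; rewrite ei ed eB ec ea -!PoszM -!PoszD dE addr_nat.
  have id : (i < i * d ^ 2)%N.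
    rewrite -[X in (X < _)%N]muln1 ltn_mul2l i0 -mulnn.
    by apply: leq_trans d2 _; rewrite leq_pmulr.
  rewrite tab ?id ?idI // -qroot_div // -/x.
  have aE : acc i (B * B) - \sum_(2 <= d' < d) mertens (x %/ d') - mertens (x %/ d) =
      acc i (B * B) - \sum_(2 <= d' < d.+1) mertens (x %/ d').
    by rewrite big_nat_recr //= opprD addrA.
  rewrite aE; split=> //; [by rewrite acc_addr ?idI|exact: aV|].
  split=> //; first by rewrite absz_nat addn1 (leq_trans (dB d _) (ltnW BV)) // d0.
  by split=> //; rewrite /= addn1.
have stop s' : Inv b s' -> eval_expr s' (!ri [*] !rd [*] !rd [<=] !rI) = 0.
  move=> [[eB eI ei ed] ec ea]; rewrite /= ei ed eI -!PoszM lez_nat -mulnA mulnn.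
  by rewrite leq_index // ltnn.
have Inv1 : Inv 2 s1 by split=> //=; rewrite big_geq // subr0.
have bB : (b - 2 <= B)%N.
  have := dB b.-1; rewrite prednK ?leqnn ?andbT; last exact: ltnW.
  by move: b2; clear; case: b => [|[|b]] //= _ /(_ isT); lia.
apply: triple_seq.
apply: (triple_weaken _ _ (triple_frame
  (triple_for_const V_gt1 (Inv := Inv) _ b2 step stop Inv1))) => //.
  by rewrite leq_add2r leq_mul2r bB orbT.
move=> s2 [[[eB eI ei ed] ec ea] fr2].
have eM : regs s2 rM = mertens (B * B) by rewrite fr2.
have eS : regs s2 rS = small_part (B * B) + large_part i by rewrite fr2.
have mx : acc i (B * B) - \sum_(2 <= d' < b) mertens (x %/ d') = mertens x.
  by rewrite (mertens_recursion Dx).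
have SE : small_part (B * B) + large_part i + (mertens x - mertens (B * B)) =
    small_part (B * B) + large_part i.-1.
  by rewrite /large_part prednK // [in RHS]big_ltn // -/x -addrA; congr (_ + _); rewrite addrC.
have i1 : (i%:Z - 1%N%:Z = i.-1%:Z :> int) by clear -i0; lia.
run_block; rewrite eB ei ea mx -!PoszD addr_nat eM eS SE i1 ec.
split=> //; [exact: acc_addr|by rewrite -mx aV|].
split=> //; first exact: total_abs.
split=> //.
  by rewrite absz_nat (leq_trans (leq_pred _)) // ltnW // (leq_ltn_trans leiI) // (ltn_trans ltI_B).
split=> //=; first by rewrite eqxx.
by move=> a ai; rewrite eqz_nat (negPf ai).
Qed.

Lemma triple_combine s : env s -> regs s rM = mertens (B * B) ->
  regs s rS = small_part (B * B) -> (forall i, (0 < i <= I)%N -> entry (B * B) i s) ->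
  triple V mem combine s
    (block_time + ((I - 0) * (combine_body_time + step_time) + step_time))%N
    (fun s' => regs s' rS = (square_free_count n)%:Z).
Proof.
move=> [sn sB sI] sM sS ent.
have IV : (I <= V)%N by apply: ltnW; apply: ltn_trans ltI_B ltB_V.
apply: triple_seq; run_block; rewrite sI; split=> //; set s1 := set_reg _ _ _.
pose Inv k s' := [/\ [/\ env s', regs s' rM = mertens (B * B) & regs s' ri = (I - k)%N%:Z],
  regs s' rS = small_part (B * B) + large_part (I - k),
  forall i, (0 < i <= I - k)%N -> entry (B * B) i s' &
  forall j, (I - k < j <= I)%N -> cells s' (B + B + j)%N%:Z = mertens (qroot n j)].
apply: (triple_weaken (leqnn _) _ (triple_for_const V_gt1 (Inv := Inv) _ _ _ _ (a := 0%N) (b := I) _)) => //.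
- move=> s' [_ -> _ _]; rewrite (square_free_count_split n (B * B)).
  by rewrite subnn /large_part IE mulnn.
- move=> k s' /andP[_ kI] [[es' eM ei] eS ent' tab]; have [en eB eI] := es'.
  rewrite /= ei lez_nat guardE subn_gt0 kI; split=> //.
  have iI : (0 < I - k <= I)%N by rewrite subn_gt0 kI leq_subr.
  have ii : (0 < I - k <= I - k)%N by rewrite subn_gt0 kI leqnn.
  apply: (triple_weaken (leqnn _) _ (triple_frame
    (triple_combine_body es' ei iI eM eS (ent' _ ii) tab))) => //.
  move=> s2 [[e2i e2S c2i c2] fr2].
  have kE : (I - k).-1 = (I - k.+1)%N by rewrite subnS.
  rewrite kE in e2i e2S; split=> //.
  + by split; [split; rewrite fr2|rewrite fr2|].
  + move=> i /andP[i0 ik]; have [h1 h2] : entry (B * B) i s'.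
      by apply: ent'; rewrite i0 (leq_trans ik) // leq_sub2l.
    by split; rewrite c2 //; apply/eqP; move: ik kI i0 ltI_B; clear; lia.
  move=> j /andP[kj jI]; have [->//|ji] := eqVneq j (I - k)%N.
  rewrite c2 ?eqn_add2l // tab // jI andbT ltn_neqAle eq_sym ji.
  by move: kj kI; clear; lia.
- by move=> s' [[_ _ ei] _ _ _]; rewrite /= ei subnn.
- split=> //=; rewrite ?subn0 //.
  + by rewrite /large_part big_geq // addr0.
  by move=> j /andP[h1 h2]; move: (leq_trans h1 h2); rewrite ltnn.
Qed.

Definition total_time : nat :=
  (block_time + ((B - 1) * (block_time + step_time) + step_time) +
  (block_time + ((I.+1 - 1) * (root_time + step_time) + step_time) +
  (all_segments_time +
  (block_time + ((I - 0) * (combine_body_time + step_time) + step_time) +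
   block_time))))%N.

Lemma triple_program s : regs s rn = n%:Z ->
  triple V mem square_free_program s total_time
    (fun s' => regs s' rn = (square_free_count n)%:Z).
Proof.
move=> sn.
apply: triple_seq; apply: (triple_weaken (leqnn _) _ (triple_find_base sn)) => //.
move=> s1 [s1n s1B].
apply: triple_seq; apply: (triple_weaken (leqnn _) _ (triple_find_roots s1n s1B)) => //.
move=> s2 [es2 ent2].
apply: triple_seq; apply: (triple_weaken (leqnn _) _ (triple_all_segments es2 ent2)) => //.
move=> s3 [es3 eM eS ent3].
apply: triple_seq; apply: (triple_weaken (leqnn _) _ (triple_combine es3 eM eS ent3)) => //.
move=> s4 eS4; run_block; rewrite eS4; split=> //.
rewrite absz_nat /square_free_count (leq_trans (count_size _ _)) // size_iota.
exact: n_V.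
Qed.

End Program.

(** * Counting steps, and the asymptotic bounds *)

(** Dyadic blocks: for 2^k <= d < 2^(k+1) there are 2^k terms, each at most
    B / 2^k. *)
Lemma harmonic_sum_leq B : (0 < B)%N ->
  (\sum_(1 <= d < B.+1) B %/ d <= B * (trunc_log 2 B).+1)%N.
Proof.
move=> B0; have B2 : (B.+1 <= 2 ^ (trunc_log 2 B).+1)%N by apply: trunc_log_ltn.
have h k : (\sum_(1 <= d < 2 ^ k) B %/ d <= B * k)%N.
  elim: k => [|k IH]; first by rewrite big_geq.
  have k0 : (0 < 2 ^ k)%N by rewrite expn_gt0.
  rewrite (@big_cat_nat _ _ _ (2 ^ k)%N 1%N (2 ^ k.+1)%N) //=; last by rewrite leq_pexp2l.
  rewrite mulnS addnC leq_add //.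
  apply: leq_trans (_ : (2 ^ k.+1 - 2 ^ k) * (B %/ 2 ^ k) <= _)%N.
    rewrite -sum_nat_const_nat big_nat [X in (_ <= X)%N]big_nat.
    by apply: leq_sum => d /andP[d1 _]; apply: leq_div2l.
  by rewrite expnS mul2n -addnn addnK mulnC leq_divM.
apply: leq_trans (h (trunc_log 2 B).+1).
by rewrite [X in (_ <= X)%N](@big_cat_nat _ _ _ B.+1) //= leq_addr.
Qed.

Lemma telescope_leq (g : nat -> nat) a m : (forall j, g j.+1 <= g j)%N ->
  (\sum_(a <= j < a + m) (g j - g j.+1) <= g a - g (a + m))%N.
Proof.
move=> gm; elim: m => [|m IH]; first by rewrite addn0 big_geq.
have ga : (g (a + m) <= g a)%N.
  by elim: m {IH} => [|m IH]; rewrite ?addn0 // addnS (leq_trans (gm _)).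
rewrite addnS big_nat_recr ?leq_addr //=.
by have := gm (a + m)%N; move: IH ga; clear; lia.
Qed.

(** The first J = B / i + 1 segments are bounded by B each; the later ones
    telescope to at most x / (J B + 1), where x is at most (J B)^2 because
    x^2 i <= n < B^5 and B <= J i. *)
Lemma sum_hits_leq n B i : (0 < B)%N -> (n < B ^ 5)%N -> (0 < i)%N ->
  (\sum_(0 <= j < B) hits n B (j * B) i <= 2 * ((B %/ i).+1 * B))%N.
Proof.
move=> B0 nB i0; set x := qroot n i; set J := (B %/ i).+1.
have Ji : (B <= J * i)%N by apply/ltnW/ltn_ceil.
have x2 : (x ^ 2 * i <= n)%N by rewrite -leq_qroot.
have xJ : (x <= (J * B) * (J * B))%N.
  rewrite leqNgt; apply/negP => Jx; move: nB; rewrite ltnNge => /negP; apply.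
  apply: leq_trans x2.
  apply: leq_trans (_ : (J * B * (J * B)) ^ 2 * i <= _)%N; last first.
    by rewrite leq_mul2r leq_sqr ltnW ?orbT.
  have -> : ((J * B * (J * B)) ^ 2 * i = (J ^ 3) * (B ^ 4) * (J * i))%N by lia.
  rewrite expnSr; apply: leq_mul => //.
  by rewrite leq_pmull // expn_gt0.
pose g j := (x %/ (j * B).+1)%N.
have gm j : (g j.+1 <= g j)%N by rewrite /g leq_div2l // ltnS leq_mul2r leqnSn orbT.
have hitsE j : hits n B (j * B) i = minn B (g j - g j.+1).
  by rewrite /hits /g mulSn [in RHS]addnC.
(* Extending the range to J + B avoids comparing J with B. *)
apply: leq_trans (_ : \sum_(0 <= j < J + B) hits n B (j * B) i <= _)%N.
  by rewrite [X in (_ <= X)%N](@big_cat_nat _ _ _ B) ?leq_addl //= leq_addr.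
rewrite (@big_cat_nat _ _ _ J) ?leq_addr //= mul2n -addnn; apply: leq_add.
  rewrite -[X in (X * B)%N]subn0 -sum_nat_const_nat.
  by apply: leq_sum => j _; rewrite hitsE geq_minl.
apply: leq_trans (_ : \sum_(J <= j < J + B) (g j - g j.+1) <= _)%N.
  by apply: leq_sum => j _; rewrite hitsE geq_minr.
apply: leq_trans (telescope_leq _ _ gm) _; apply: leq_trans (leq_subr _ _) _.
rewrite /g -ltnS ltn_divLR //; apply: leq_ltn_trans xJ _.
by clear; nia.
Qed.

Lemma sieve_time_leq B (L := trunc_log 2 B) : (0 < B)%N ->
  (sieve_time B <= 1000 * (B * (L + 2)))%N.
Proof.
move=> B0; have hB := harmonic_sum_leq B0; rewrite -/L in hB; rewrite /sieve_time.
(* Here 121 = block_time + step_time and 363 = 3 * 121. *)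
have E : (\sum_(1 <= d < B.+1) (121 * (B %/ d) + 363) =
    121 * \sum_(1 <= d < B.+1) B %/ d + B * 363)%N.
  by rewrite big_split -big_distrr sum_nat_const_nat subn1.
have : (\sum_(2 <= d < B.+1) (sieve_by_time B d + step_time) <=
    \sum_(1 <= d < B.+1) (121 * (B %/ d) + 363))%N.
  rewrite [X in (_ <= X)%N]big_ltn //; apply: leq_trans (leq_addl _ _).
  by apply: leq_sum => d _; rewrite /sieve_by_time /block_time /step_time /max_cost; lia.
rewrite E; move: hB B0.
move: (\sum_(1 <= d < B.+1) B %/ d)%N => h.
move: (\sum_(2 <= d < B.+1) (sieve_by_time B d + step_time))%N => s.
by rewrite /block_time /step_time /max_cost; clear; nia.
Qed.

Lemma sum_gather_leq n B I (L := trunc_log 2 B) : (0 < B)%N -> (n < B ^ 5)%N -> (I < B)%N ->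
  (\sum_(0 <= j < B) gather_total n B I (j * B) <= 1000 * (B * B * (L + 2)))%N.
Proof.
move=> B0 nB IB; have hB := harmonic_sum_leq B0; rewrite -/L in hB.
(* Again 121 = block_time + step_time, and 242 = 2 * 121. *)
pose c := 121%N; pose e := 242%N.
have gE j : gather_total n B I (j * B) =
    (121 + (I * 242 + 121 * \sum_(1 <= i < I.+1) hits n B (j * B) i))%N.
  rewrite /gather_total (eq_bigr (fun i => e + c * hits n B (j * B) i)%N); last first.
    by move=> i _; rewrite /gather_time /block_time /step_time /max_cost /c /e; lia.
  rewrite big_split -big_distrr sum_nat_const_nat subn1 /c /e /=.
  by rewrite /block_time /step_time /max_cost; lia.
rewrite (eq_bigr _ (fun j _ => gE j)) big_split sum_nat_const_nat subn0 big_split.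
rewrite sum_nat_const_nat subn0 -big_distrr exchange_big_nat /=.
have h : (\sum_(1 <= i < I.+1) \sum_(0 <= j < B) hits n B (j * B) i <=
    2 * B * (B * L.+1 + B))%N.
  apply: leq_trans (_ : \sum_(1 <= i < I.+1) 2 * B * ((B %/ i) + 1) <= _)%N.
    rewrite big_nat [X in (_ <= X)%N]big_nat; apply: leq_sum => i /andP[i0 _].
    by apply: leq_trans (sum_hits_leq B0 nB i0) _; rewrite addn1 (mulnC _ B) mulnA.
  rewrite -big_distrr leq_mul2l; apply/orP; right; rewrite big_split leq_add //.
    apply: leq_trans hB.
    by rewrite [X in (_ <= X)%N](@big_cat_nat _ _ _ I.+1) ?leq_addr // ltnW.
  by rewrite sum_nat_const_nat subn1 muln1 ltnW.
move: h IB B0; clear.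
move: (\sum_(1 <= i < I.+1) \sum_(0 <= j < B) hits n B (j * B) i)%N => s.
by nia.
Qed.

Definition time_factor : nat := 5000.

Lemma total_time_leq n B I (L := trunc_log 2 B) : (0 < B)%N -> (n < B ^ 5)%N -> (I < B)%N ->
  (total_time n B I <= time_factor * (B * B * (L + 2)))%N.
Proof.
move=> B0 nB IB; have h1 := sieve_time_leq B0; have h2 := sum_gather_leq B0 nB IB.
rewrite -/L in h1 h2.
rewrite /time_factor /total_time /all_segments_time /root_time /search_time /combine_body_time.
have E : (\sum_(0 <= j < B) (segment_time n B I (j * B) + step_time) =
    B * (sieve_time B + (2 * (B * 121) + 363)) +
    \sum_(0 <= j < B) gather_total n B I (j * B))%N.
  rewrite -[X in (X * (_ + _))%N]subn0 -sum_nat_const_nat -big_split /=.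
  apply: eq_bigr => j _; rewrite /segment_time subn0.
  rewrite /block_time /step_time /max_cost; lia.
rewrite E; move: h1 h2 IB B0; clear.
move: (sieve_time B) (\sum_(0 <= j < B) gather_total n B I (j * B))%N => s t.
rewrite /block_time /step_time /max_cost; nia.
Qed.

Lemma base_exists n : exists b, (n < b ^ 5)%N.
Proof. by exists n.+1; rewrite -[X in (X < _)%N]expn1; apply: (@leq_pexp2l n.+1 1). Qed.

Definition base (n : nat) : nat := ex_minn (base_exists n).

Lemma baseP n : [/\ (0 < base n)%N, (n < base n ^ 5)%N & ((base n).-1 ^ 5 <= n)%N].
Proof.
rewrite /base; case: ex_minnP => b nb bmin.
have b0 : (0 < b)%N by case: (b) nb.
split=> //; rewrite leqNgt; apply/negP => /bmin.
by rewrite leqNgt prednK ?leqnn.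
Qed.

(** All the values stored are at most 8 (n + 2)^3, which serves as the bound V. *)
Definition value_bound (n : nat) : nat := (8 * (n.+2 * n.+2 * n.+2))%N.

Lemma program_correct n : (0 < n)%N ->
  exists t, (t <= time_factor * (base n * base n * (trunc_log 2 (base n) + 2)))%N /\
  exists2 s, exec (value_bound n ^ max_cost) (4 * base n) square_free_program (init_state n) t s
           & regs s 0%N = (square_free_count n)%:Z.
Proof.
move=> n0; have [B0 nB Bn] := baseP n.
have V1 : (1 < value_bound n)%N by rewrite /value_bound; nia.
pose I := (n %/ (base n ^ 2).+1 ^ 2)%N.
have IB := ltI_B nB (erefl I).
have [] := triple_program V1 n0 B0 nB Bn erefl (leqnn _) (erefl I) erefl (s := init_state n) erefl.
  by split=> [r|a] //=; case: eqP => // _; rewrite /value_bound absz_nat; nia.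
move=> t [s [ex tT _ sE]]; exists t; split; last by exists s.
exact: leq_trans tT (total_time_leq B0 nB IB).
Qed.

Section Asymptotics.
Variable R : realType.

Lemma soft_bigO_intro (f : nat -> nat) (g : nat -> R) (k : nat) (C : R) : 0 < C ->
  (forall n, (1 < n)%N -> (f n)%:R <= C * (g n * ln n%:R ^+ k)) -> soft_bigO f g.
Proof.
move=> C0 fg; exists k; apply/eqO_exP; exists C => //.
exists 2%N => // n /= n1; rewrite ger0_norm ?ler0n //.
by apply: le_trans (fg n n1) _; rewrite ler_pM2l // ler_norm.
Qed.

(** By minimality (B - 1)^5 <= n, and 1 <= n^(1/5). *)
Lemma base_leq_root n : (0 < n)%N -> (base n)%:R <= 2 * (n%:R : R) `^ (1 / 5).
Proof.
move=> n0; have [B0 _ Bn] := baseP n.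
have r1 : 1 <= (n%:R : R) `^ (1 / 5).
  by rewrite -[X in X <= _](powRr0 n%:R) ler_powR ?ler1n //; lra.
have : ((base n).-1)%:R <= (n%:R : R) `^ (1 / 5).
  have -> : ((base n).-1)%:R = (((base n).-1 ^ 5)%N%:R : R) `^ (1 / 5).
    rewrite natrX -powR_mulrn // -powRrM (_ : 5%:R * (1 / 5) = 1 :> R) ?powRr1 //.
    by rewrite mul1r divff // pnatr_eq0.
  by apply: ge0_ler_powR; rewrite ?nnegrE ?ler_nat //; lra.
by rewrite -subn1 natrB // => h; lra.
Qed.

Lemma base_sqr_leq n : (0 < n)%N -> (base n * base n)%N%:R <= 4 * (n%:R : R) `^ (2 / 5).
Proof.
move=> n0; have h := base_leq_root n0.
have -> : (n%:R : R) `^ (2 / 5) = (n%:R `^ (1 / 5)) * (n%:R `^ (1 / 5)).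
  rewrite -powRD; first by congr (_ `^ _); lra.
  by apply/implyP => _; rewrite pnatr_eq0 -lt0n.
rewrite natrM; move: h (powR_ge0 (n%:R : R) (1 / 5)) (ler0n R (base n)).
move: (n%:R `^ (1 / 5)) ((base n)%:R : R) => r b h r0 b0.
by have := ler_pM b0 b0 h h; lra.
Qed.

(** 2^L <= B <= n + 1 <= n^2, and 2 ln 2 <= 2 ln n absorbs the constant. *)
Lemma log_base_leq n : (1 < n)%N ->
  (trunc_log 2 (base n) + 2)%N%:R <= 4 / ln 2 * (ln n%:R : R).
Proof.
move=> n1; have n0 := ltnW n1; have [B0 _ Bn] := baseP n.
have ln2 : 0 < ln 2 :> R by rewrite ln_gt0 // ltr1n.
set L := trunc_log 2 (base n).
have Ln : (2 ^ L <= n ^ 2)%N.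
  apply: leq_trans (trunc_logP _ B0) _ => //.
  have : ((base n).-1 <= n)%N.
    apply: leq_trans Bn; case: (base n).-1 => // b.
    by rewrite -[X in (X <= _)%N]expn1 leq_pexp2l.
  by rewrite -mulnn; nia.
have lnL : L%:R * ln 2 <= 2 * ln n%:R :> R.
  rewrite mulr_natl mulr_natl -!lnXn ?ltr0n //.
  by rewrite ler_ln ?posrE ?exprn_gt0 ?ltr0n // -!natrX ler_nat.
have ln2n : ln 2 <= ln n%:R :> R by rewrite ler_ln ?posrE ?ltr0n // ler_nat.
rewrite mulrAC ler_pdivlMr // natrD mulrDl.
by lra.
Qed.
End Asymptotics.

Theorem mainTheorem3 :
  exists (c : cmd) (time memory word : nat -> nat),
    [/\ computes_within c square_free_count time memory word,
        polynomially_bounded word,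
        forall R : realType,
          soft_bigO time (fun n => (n%:R : R) `^ (2 / 5))
      & forall R : realType,
          soft_bigO memory (fun n => (n%:R : R) `^ (1 / 5))].
Proof.
pose runs n t := (0 < n)%N ->
  (t <= time_factor * (base n * base n * (trunc_log 2 (base n) + 2)))%N /\
  exists2 s, exec (value_bound n ^ max_cost) (4 * base n) square_free_program
               (init_state n) t s
           & regs s 0%N = (square_free_count n)%:Z.
have [time timeP] : exists time : nat -> nat, forall n, runs n (time n).
  suff /choice[time h] : forall n, exists t, runs n t by exists time.
  move=> n; have [->|n0] := posnP n; first by exists 0%N.
  by have [t ht] := program_correct n0; exists t.
exists square_free_program, time, (fun n => 4 * base n)%N,
  (fun n => value_bound n ^ max_cost)%N; split.
- by move=> n n0; have [_] := timeP n n0.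
- exists (9 * max_cost)%N; exists 2%N => // n /= n1.
  rewrite expnM leq_exp2r // /value_bound; apply: leq_trans (_ : (n ^ 3) ^ 3 <= _)%N.
    have h1 : (n.+2 <= 2 * n)%N by lia.
    apply: leq_trans (_ : 8 * (2 * n * (2 * n) * (2 * n)) <= _)%N.
      by rewrite leq_mul2l /= !leq_mul.
    have -> : (8 * (2 * n * (2 * n) * (2 * n)) = 2 ^ 6 * n ^ 3)%N by lia.
    by rewrite -expnM [X in (_ <= n ^ X)%N](_ : _ = 6 + 3)%N // expnD leq_mul2r leq_exp2r ?n1 ?orbT.
  by rewrite -expnM.
- move=> R; apply: (@soft_bigO_intro R _ _ 1 (time_factor%:R * 16 / ln 2)).
    by rewrite divr_gt0 ?mulr_gt0 ?ltr0n // ln_gt0 // ltr1n.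
  move=> n n1; have n0 := ltnW n1; have [tn _] := timeP n n0.
  have hB := base_sqr_leq R n0; have hL := log_base_leq R n1.
  apply: le_trans (_ : (time_factor * (base n * base n * (trunc_log 2 (base n) + 2)))%N%:R <= _).
    by rewrite ler_nat.
  rewrite natrM natrM expr1.
  have hBL := ler_pM (ler0n R _) (ler0n R _) hB hL.
  apply: le_trans (_ : time_factor%:R * (4 * n%:R `^ (2 / 5) * (4 / ln 2 * ln n%:R)) <= _).
    by rewrite ler_wpM2l.
  rewrite le_eqVlt; apply/orP; left; apply/eqP.
  move: (time_factor%:R : R) => K; field.
  by rewrite gt_eqF // ln_gt0 // ltr1n.
- move=> R; apply: (@soft_bigO_intro R _ _ 0 8) => // n n1.
  by rewrite expr0 mulr1 natrM; have := base_leq_root R (ltnW n1); lra.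
Qed.
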